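(* For every pair $(b,k)$ in the set $\{(6,6),(7,6),(8,6),(9,6),(10,6),(11,6),(12,6),(13,6),(14,6),(8,7),(9,7),(10,7),(11,7),(12,7),(13,7),(14,7),(10,8),(11,8),(12,8),(13,8),(14,8),(11,9),(12,9),(13,9),(14,9),(13,10),(14,10),(14,11)\}$ one has the strict inequality $$R_{(b,k)}<\left(\frac{1}{\log\frac{b}{k-3}}+\frac{b^{k-1}}{b^{\underline{k-1}}\log(b-k+2)}\right)^{-1},$$ where $b^{\underline{k-1}}=b(b-1)\cdots(b-k+2)$.
   Context: All logarithms are to base 2. For integers $b\ge k$ and $n\ge1$, a $(b,k)$-hash code of length $n$ is a subset $C\subseteq\{1,\dots,b\}^n$ such that for any $k$ distinct elements of $C$ there is a coordinate in which they are pairwise distinct; $A(b,k,n)$ is the largest size of such a code and $R_{(b,k)}=\limsup_{n\to\infty}\frac1n\log A(b,k,n)$. *)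

(* Defs.v *)
From HB Require Import structures.
From mathcomp Require Import all_boot all_order all_algebra.
From mathcomp Require Import all_classical all_reals all_analysis.
Set Implicit Arguments. Unset Strict Implicit. Unset Printing Implicit Defensive.
Import Order.TTheory GRing.Theory Num.Theory.

(* Alphabet {1,...,b} is represented by 'I_b; words of length n by n.-tuple 'I_b. *)

Definition hash_code (b k n : nat) (C : {set n.-tuple 'I_b}) : Prop :=
  forall S : {set n.-tuple 'I_b}, S \subset C -> #|S| = k ->
    exists i : 'I_n, {in S &, injective (fun x : n.-tuple 'I_b => tnth x i)}.

Definition A_hash (b k n : nat) : nat :=
  \max_(C : {set n.-tuple 'I_b} | `[< hash_code k C >]) #|C|.

Local Open Scope ring_scope.

Definition log2 {R : realType} (x : R) : R := ln x / ln 2.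

Definition R_hash {R : realType} (b k : nat) : \bar R :=
  limn_esup (fun n : nat => ((log2 (A_hash b k n)%:R) / n%:R)%:E).

Definition hash_bound {R : realType} (b k : nat) : R :=
  (1 / log2 (b%:R / (k - 3)%:R)
   + (b ^ (k - 1))%:R / ((b ^_ (k - 1))%:R * log2 (b - k + 2)%:R))^-1.

Definition hash_pairs : seq (nat * nat) :=
  [:: (6,6);(7,6);(8,6);(9,6);(10,6);(11,6);(12,6);(13,6);(14,6);
      (8,7);(9,7);(10,7);(11,7);(12,7);(13,7);(14,7);
      (10,8);(11,8);(12,8);(13,8);(14,8);
      (11,9);(12,9);(13,9);(14,9);(13,10);(14,10);(14,11)].

(* Main.v *)
Require Import Defs.
From HB Require Import structures.
From mathcomp Require Import all_boot all_order all_algebra.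
From mathcomp Require Import all_classical all_reals all_analysis.
From Stdlib Require BinNat Nnat.
From mathcomp Require Import ring lra.
Set Implicit Arguments. Unset Strict Implicit. Unset Printing Implicit Defensive.
Import Order.TTheory GRing.Theory Num.Theory.
Import numFieldNormedType.Exports.
Local Open Scope ring_scope.

(** Put m = k - 2 and let psi(p; f) be the probability that m independent symbols
    of law p and one symbol of law f are pairwise distinct.  Hansel's lemma,
    applied to m codewords x, bounds ln #|C| by ln (b - m) times the sum over the
    coordinates of the proportion of codewords y for which the symbols of x and y
    are pairwise distinct.  The codewords x are drawn from a random box, which
    prescribes on the first l coordinates a window of m symbols; boxes still
    contain many codewords as long as (b / m)^l is much smaller than #|C|.

    In each coordinate this leads to the average of psi(p; f) over random laws p
    of mean f.  Completing a square in f - uniform replaces it by the maximum over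
    single laws p of an affine combination of elementary symmetric polynomials,
    and such a maximum is attained at a law that is uniform on its support: what
    remains is a finite computation.  The result is that a coordinate contributes
    at most U = b^_(k-1) / b^(k-1), and at most (2 / (b - 1)) U when it is one of
    the first l.  Windows of size k - 2 (instead of k - 3, which would give a
    contribution 0 but need more boxes) are what makes the final inequality
    strict. *)

(** * Elementary symmetric polynomials *)

Section ElementarySymmetric.
Variables (R : realFieldType) (T : finType).
Implicit Types (p : T -> R) (i j : T).

(** Zeroing a weight stands for deleting the symbol without changing the index type: a zero variable
    does not affect elementary symmetric polynomials. *)
Definition zap i p : T -> R := fun l => if l == i then 0 else p l.

(** The generating polynomial: splitting off one factor gives the recursion [elsym_zap], expanding
    the product gives the subset sum [elsymE]. *)
Definition elsym_gen p : {poly R} := \prod_l (1 + p l *: 'X).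

Definition elsym p r : R := (elsym_gen p)`_r.

Lemma elsym_gen_zap i p : elsym_gen p = (1 + p i *: 'X) * elsym_gen (zap i p).
Proof.
rewrite /elsym_gen (bigD1 i) //= [in RHS](bigD1 i) //= /zap eqxx scale0r addr0 mul1r.
by congr (_ * _); apply: eq_bigr => l /negbTE ->.
Qed.

Lemma eq_elsym p q r : p =1 q -> elsym p r = elsym q r.
Proof. by move=> pq; rewrite /elsym /elsym_gen; under eq_bigr do rewrite pq. Qed.

Lemma elsym0 p : elsym p 0 = 1.
Proof.
rewrite /elsym -horner_coef0 horner_prod big1 // => l _.
by rewrite !hornerE.
Qed.

Lemma elsym_zap i p r :
  elsym p r.+1 = elsym (zap i p) r.+1 + p i * elsym (zap i p) r.
Proof.
by rewrite /elsym (elsym_gen_zap i) mulrDl mul1r coefD -scalerAl coefZ coefXM.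
Qed.

Lemma elsymE p r : elsym p r = \sum_(A : {set T} | #|A| == r) \prod_(l in A) p l.
Proof.
rewrite /elsym /elsym_gen.
under eq_bigr do rewrite addrC.
rewrite bigA_distr coef_sum [RHS]big_mkcond /=.
apply: eq_bigr => A _.
rewrite (bigID (mem A)) /= [X in _ * X]big1 ?mulr1; last by move=> l /negbTE ->.
rewrite (eq_bigr (fun l => p l *: 'X)); last by move=> l ->.
by rewrite scaler_prod prodr_const coefZ coefXn eq_sym; case: eqP; rewrite (mulr1, mulr0).
Qed.

Lemma elsym_ge0 p r : (forall l, 0 <= p l) -> 0 <= elsym p r.
Proof. by move=> p0; rewrite elsymE sumr_ge0 // => A _; rewrite prodr_ge0. Qed.

Lemma zap_ge0 i p : (forall l, 0 <= p l) -> forall l, 0 <= zap i p l.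
Proof. by move=> p0 l; rewrite /zap; case: ifP. Qed.

(** The summand of i collects the products over the sets of size r + 1 that contain i, so each set
    is counted once for each of its elements. *)
Lemma sum_elsym_zap p r : \sum_i p i * elsym (zap i p) r = r.+1%:R * elsym p r.+1.
Proof.
transitivity (\sum_i \sum_(B : {set T} | (#|B| == r.+1) && (i \in B))
    \prod_(l in B) p l).
  apply: eq_bigr => i _; have -> : p i * elsym (zap i p) r =
      elsym p r.+1 - elsym (zap i p) r.+1 by rewrite (elsym_zap i p r) addrC addKr.
  rewrite !elsymE (bigID (fun B : {set T} => i \in B)) /=.
  rewrite [X in _ - X](bigID (fun B : {set T} => i \in B)) /=.
  rewrite [X in _ - (X + _)]big1 ?add0r; last first.
    by move=> B /andP[_ iB]; rewrite (bigD1 i) //= /zap eqxx mul0r.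
  rewrite [X in _ - X](eq_bigr (fun B : {set T} => \prod_(l in B) p l)) ?addrK //.
  move=> B /andP[_ iB]; apply: eq_bigr => l lB; rewrite /zap; case: eqP => // li.
  by move: iB; rewrite -li lB.
rewrite (exchange_big_dep (fun B : {set T} => #|B| == r.+1)) /=; last by move=> ? ? _ /andP[].
rewrite elsymE mulr_sumr; apply: eq_bigr => B /eqP <-.
rewrite (eq_bigl (fun i => i \in B)); last by move=> i /=; rewrite eqxx.
by rewrite sumr_const mulr_natl.
Qed.

Lemma elsym1 p : elsym p 1 = \sum_i p i.
Proof.
have := sum_elsym_zap p 0; rewrite mul1r => <-.
by apply: eq_bigr => i _; rewrite elsym0 mulr1.
Qed.

Lemma elsym2 p : \sum_i p i = 1 -> \sum_i p i ^+ 2 = 1 - 2 * elsym p 2.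
Proof.
move=> p1; have := sum_elsym_zap p 1 => <-.
rewrite -[1 in RHS]p1 -sumrB; apply: eq_bigr => i _.
have := elsym_zap i p 0; rewrite elsym0 mulr1 elsym1 p1 => h.
by have -> : elsym (zap i p) 1 = 1 - p i; [lra|ring].
Qed.

Lemma elsym_supp p r (S : {set T}) :
  (forall l, l \notin S -> p l = 0) -> (#|S| < r)%N -> elsym p r = 0.
Proof.
move=> pS Sr; rewrite elsymE big1 // => A /eqP rA.
have [AS|/subsetPn[l lA lS]] := boolP (A \subset S).
  by move: (leq_trans Sr (eq_leq (esym rA))); rewrite ltnNge subset_leq_card.
by rewrite (bigD1 l) //= pS // mul0r.
Qed.

Lemma elsym_unif (S : {set T}) (c : R) p r :
  (forall l, p l = if l \in S then c else 0) ->
  elsym p r = 'C(#|S|, r)%:R * c ^+ r.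
Proof.
move=> pE; rewrite elsymE.
rewrite (bigID (fun A : {set T} => A \subset S)) /= [X in _ + X]big1 ?addr0; last first.
  by move=> A /andP[_ /subsetPn[l lA lS]]; rewrite (bigD1 l) //= pE (negbTE lS) mul0r.
rewrite (eq_bigr (fun=> c ^+ r)); last first.
  move=> A /andP[/eqP <- AS]; rewrite -prodr_const; apply: eq_bigr => l lA.
  by rewrite pE (fintype.subsetP AS).
rewrite sumr_const mulr_natl -cards_draws; congr (_ *+ _).
by apply: eq_card => A; rewrite !inE andbC.
Qed.

(** Group the injections by image: each set of size m is the image of m! of them. *)
Lemma sum_inj_prod p m :
  \sum_(s : {ffun 'I_m -> T} | injectiveb s) \prod_j p (s j) = m`!%:R * elsym p m.
Proof.
rewrite elsymE (partition_big (fun s : {ffun 'I_m -> T} => s @: [set: 'I_m]%SET)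
   (fun A : {set T} => #|A| == m)) /=; last first.
  by move=> s /injectiveP si; rewrite card_imset // cardsT card_ord.
rewrite mulr_sumr; apply: eq_bigr => A /eqP Am.
rewrite (eq_bigr (fun=> \prod_(l in A) p l)); last first.
  move=> s /andP[/injectiveP si /eqP <-]; rewrite big_imset /=; last by move=> ? ? _ _; exact: si.
  by apply: eq_bigl => j; rewrite inE.
rewrite sumr_const mulr_natl -(ffactnn m); congr (_ *+ _).
have := card_inj_ffuns_on 'I_m (mem A); rewrite card_ord Am => <-.
apply: eq_card => s; rewrite unfold_in [RHS]inE andbC.
have [/injectiveP si|_] := boolP (injectiveb s); rewrite ?andbF // !andbT.
apply/eqP/ffun_onP => [<- j|sA]; first by rewrite imset_f.
apply/eqP; rewrite eqEcard card_imset // cardsT card_ord Am leqnn andbT.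
by apply/fintype.subsetP => _ /imsetP[j _ ->].
Qed.

End ElementarySymmetric.

(** * Maxima of combinations of elementary symmetric polynomials on a simplex *)

Section SimplexMaximum.
Variables (R : realType) (b N : nat) (c : nat -> R).
Implicit Types (p q : 'I_b -> R) (S : {set 'I_b}).

Definition simplex S p : Prop :=
  [/\ forall l, 0 <= p l, forall l, l \notin S -> p l = 0 & \sum_l p l = 1].

Definition elsym_comb p : R := \sum_(r < N) c r * elsym p r.

Definition reset2 i j x y p : 'I_b -> R :=
  fun l => if l == i then x else if l == j then y else p l.

Lemma eq_elsym_comb p q : p =1 q -> elsym_comb p = elsym_comb q.
Proof. by move=> pq; apply: eq_bigr => r _; rewrite (eq_elsym _ pq). Qed.

(** The generating polynomial is (1 + x X)(1 + y X) times a factor free of x and y, so x and y enter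
    only through x y and the fixed sum x + y. *)
Lemma elsym_comb_pair i j p : i != j -> exists A B : R, forall x y,
  x + y = p i + p j -> elsym_comb (reset2 i j x y p) = A + B * (x * y).
Proof.
move=> ij; pose q := elsym_gen (zap i (zap j p)).
pose L (P : {poly R}) := \sum_(r < N) c r * P`_r.
have LD P Q : L (P + Q) = L P + L Q.
  by rewrite -big_split; apply: eq_bigr => r _; rewrite coefD mulrDr.
have LZ a P : L (a *: P) = a * L P.
  by rewrite mulr_sumr; apply: eq_bigr => r _; rewrite coefZ mulrCA.
exists (L q + (p i + p j) * L ('X * q)), (L ('X * ('X * q))) => x y xy.
have -> : elsym_comb (reset2 i j x y p) = L (elsym_gen (reset2 i j x y p)) by [].
rewrite (elsym_gen_zap i) (elsym_gen_zap j (zap i _)).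
have -> : elsym_gen (zap j (zap i (reset2 i j x y p))) = q.
  apply: eq_bigr => l _; congr (1 + _ *: _); rewrite /zap /reset2.
  by case: (l == i); case: (l == j).
rewrite /reset2 /zap !eqxx [j == i]eq_sym (negbTE ij).
have -> : (1 + x *: 'X) * ((1 + y *: 'X) * q) =
    q + (x + y) *: ('X * q) + (x * y) *: ('X * ('X * q)).
  rewrite !mulrDl !mul1r -!scalerAl mulrDr -!scalerAr scalerDr scalerA scalerDl.
  by rewrite addrACA -!addrA; congr (_ + _); rewrite addrCA.
by rewrite !LD !LZ xy; ring.
Qed.

Lemma reset2_sum i j x y p : i != j -> x + y = p i + p j ->
  \sum_l reset2 i j x y p l = \sum_l p l.
Proof.
move=> ij xy; rewrite (bigD1 i) // (bigD1 j) 1?eq_sym //= [in RHS](bigD1 i) //.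
rewrite [in RHS](bigD1 j) 1?eq_sym //= /reset2 !eqxx [j == i]eq_sym (negbTE ij).
rewrite !addrA xy; congr (_ + _); apply: eq_bigr => l /andP[/negbTE -> /negbTE ->].
by [].
Qed.

Lemma reset2_id i j p : reset2 i j (p i) (p j) p =1 p.
Proof. by move=> l; rewrite /reset2; do 2!case: eqP => [->|_] //. Qed.

Lemma reset2_simplex S i j x y p : i != j -> i \in S -> j \in S ->
  0 <= x -> 0 <= y -> x + y = p i + p j ->
  simplex S p -> simplex S (reset2 i j x y p).
Proof.
move=> ij iS jS x0 y0 xy [p0 pS p1]; split; last by rewrite reset2_sum.
  by move=> l; rewrite /reset2; case: ifP => // _; case: ifP.
move=> l lS; rewrite /reset2; case: eqP => [li|_]; first by rewrite -li (negbTE lS) in iS.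
by case: eqP => [lj|_]; [rewrite -lj (negbTE lS) in jS | exact: pS].
Qed.

(* Along a segment with [p i + p j] fixed the combination is affine in
   [p i * p j], so a maximizer either can be evened out or can lose a point of
   its support; a maximizer of minimal support is uniform. *)
Lemma elsym_comb_maximizer S K :
  (forall n, (0 < n <= #|S|)%N ->
     \sum_(r < N) c r * ('C(n, r)%:R * n%:R^-1 ^+ r) <= K) ->
  forall p, simplex S p ->
  (forall q, simplex S q -> elsym_comb q <= elsym_comb p) -> elsym_comb p <= K.
Proof.
move=> HK p; have [n] := ubnP #|[set l | p l != 0]%SET|.
elim: n p => // n IHn p; rewrite ltnS => pn sp pmax.
have [p0 pS p1] := sp.
set D := [set l | p l != 0]%SET.
have DS : D \subset S.
  by apply/fintype.subsetP => l; rewrite inE; apply: contraNT => /pS ->.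
have [/forallP/= Heq|] := boolP [forall i in D, forall j in D, p i == p j]; last first.
  rewrite negb_forall => /existsP[i]; rewrite negb_imply => /andP[iD].
  rewrite negb_forall => /existsP[j]; rewrite negb_imply => /andP[jD pij].
  have ij : i != j by apply: contraNneq pij => ->.
  have iS := fintype.subsetP DS _ iD; have jS := fintype.subsetP DS _ jD.
  have [A [B AB]] := elsym_comb_pair p ij.
  have pE : elsym_comb p = A + B * (p i * p j).
    by rewrite -AB //; apply: eq_elsym_comb => l; rewrite reset2_id.
  have [B0|B0] := leP B 0.
    have q_ge : elsym_comb p <= elsym_comb (reset2 i j (p i + p j) 0 p).
      rewrite AB ?addr0 // mulr0 mulr0 addr0 pE -lerBrDl subrr.
      by rewrite mulr_le0_ge0 ?mulr_ge0.
    have sq : simplex S (reset2 i j (p i + p j) 0 p).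
      by apply: reset2_simplex; rewrite ?addr0 ?addr_ge0.
    apply: (le_trans q_ge); apply: IHn => //; last first.
      by move=> q /pmax qp; apply: (le_trans qp).
    apply: leq_trans pn; apply: proper_card; apply/properP; split; last first.
      by exists j => //; rewrite inE /reset2 [j == i]eq_sym (negbTE ij) !eqxx.
    apply/fintype.subsetP => l; rewrite !inE /reset2; case: (eqVneq l i) => [->|_].
      by move: iD; rewrite inE.
    by case: (eqVneq l j) => // _; rewrite eqxx.
  have := pmax (reset2 i j ((p i + p j) / 2) ((p i + p j) / 2) p).
  rewrite AB ?pE; last by field.
  have sq : simplex S (reset2 i j ((p i + p j) / 2) ((p i + p j) / 2) p).
    by apply: reset2_simplex; rewrite ?divr_ge0 ?addr_ge0 //; field.
  move=> /(_ sq); rewrite lerD2l ler_pM2l // => h; exfalso.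
  move: pij; rewrite -subr_eq0 -sqrf_eq0 => h2.
  have : 0 < (p i - p j) ^+ 2 by rewrite lt0r h2 sqr_ge0.
  nra.
have [i iD] : exists i, i \in D.
  apply/set0Pn; apply: contra_eq_neq p1 => D0; rewrite big1 1?eq_sym ?oner_neq0 //.
  by move=> l _; apply/eqP; have := finset.in_set0 l; rewrite -D0 inE => /negbFE.
have pE l : p l = if l \in D then p i else 0.
  case: ifP => [lD|]; last by rewrite inE => /negbFE/eqP.
  by apply/eqP; have /implyP/(_ lD)/forallP/(_ i)/implyP/(_ iD) := Heq l.
have D0 : (0 < #|D|)%N by apply/card_gt0P; exists i.
have pi : p i = #|D|%:R^-1.
  have : \sum_l p l = #|D|%:R * p i.
    rewrite (bigID (mem D)) /= addrC big1 ?add0r; last first.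
      by move=> l lD; rewrite pE (negbTE lD).
    rewrite (eq_bigr (fun=> p i)); last by move=> l lD; rewrite pE lD.
    by rewrite sumr_const mulr_natl.
  rewrite p1 => /(congr1 ( *%R #|D|%:R^-1)); rewrite mulr1 mulKf // pnatr_eq0.
  by rewrite -lt0n.
apply: le_trans (HK #|D| _); last by rewrite D0 subset_leq_card.
rewrite /elsym_comb le_eqVlt; apply/orP; left; apply/eqP.
by apply: eq_bigr => r _; rewrite (elsym_unif _ pE) pi.
Qed.

Lemma continuous_elsym r : continuous (fun v : 'rV[R]_b => elsym (fun l => v ord0 l) r).
Proof.
have -> : (fun v : 'rV[R]_b => elsym (fun l => v ord0 l) r) =
  (fun v => \sum_(A : {set 'I_b} | #|A| == r) \prod_(l in A) v ord0 l).
  by apply: funext => v; rewrite elsymE.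
apply: continuous_big => [|A _]; first exact: add_continuous.
apply: continuous_big => [|l _]; first exact: mul_continuous.
exact: coord_continuous.
Qed.

(** Compactness of the simplex provides a maximizer, to which [elsym_comb_maximizer] applies. *)
Lemma elsym_comb_le S K :
  (forall n, (0 < n <= #|S|)%N ->
     \sum_(r < N) c r * ('C(n, r)%:R * n%:R^-1 ^+ r) <= K) ->
  forall p, simplex S p -> elsym_comb p <= K.
Proof.
move=> HK p sp.
pose vec q : 'rV[R]_b := \row_l q l.
have vecE q : (fun l => vec q ord0 l) =1 q by move=> l; rewrite mxE.
pose A : set 'rV[R]_b := [set v | simplex S (fun l => v ord0 l)]%classic.
have AE q : simplex S q -> A (vec q).
  by move=> [q0 qS q1]; split => [l|l lS|]; [rewrite vecE|rewrite vecE qS|under eq_bigr do rewrite vecE].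
have cA : compact A.
  (* The simplex is a product of segments and points, cut by the closed condition that the
     coordinates sum to 1. *)
  pose box l : set R := if l \in S then `[0, 1]%classic else [set 0]%classic.
  have -> : A = ([set v | forall l, box l (v ord0 l)] `&`
      [set v | \sum_l v ord0 l = 1])%classic.
    apply/seteqP; split => [v [v0 vS v1]|v [vb v1]].
      split => // l; rewrite /box; case: ifP => [_|/negbT/vS ->] //.
      rewrite /= in_itv /= v0 -v1 (bigD1 l) //= lerDl sumr_ge0 //.
    split => // [l|l lS]; have := vb l; rewrite /box.
      by case: ifP => _ /=; [rewrite in_itv /= => /andP[]|move=> ->].
    by rewrite (negbTE lS).
  apply: compact_closedI.
    apply: rV_compact => l; rewrite /box; case: ifP => _; last exact: compact_set1.
    exact: segment_compact.
  have cs : continuous (fun v : 'rV[R]_b => \sum_l v ord0 l).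
    apply: continuous_big => [|l _]; first exact: add_continuous.
    exact: coord_continuous.
  by have /continuous_closedP/(_ _ (@closed_eq _ (1 : R))) := cs.
have [] := @compact_EVT_max _ R (fun v : 'rV[R]_b => elsym_comb (fun l => v ord0 l)) A _ cA.
- by exists (vec p); exact: AE.
- apply: continuous_subspaceT; apply: continuous_big => [|r _]; first exact: add_continuous.
  by move=> v; apply: cvgM (@continuous_elsym _ v); exact: cvg_cst.
move=> v; rewrite inE => sv vmax.
have vmax' q : simplex S q -> elsym_comb q <= elsym_comb (fun l => v ord0 l).
  move=> /AE Aq; have := vmax (vec q); rewrite inE => /(_ Aq).
  by rewrite (eq_elsym_comb (vecE q)).
by apply: (le_trans (vmax' _ sp)); apply: elsym_comb_maximizer HK _ sv vmax'.
Qed.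

End SimplexMaximum.

(** * The average of psi over laws of given mean *)

Section KeyInequality.
Variables (R : realType) (b m' : nat).
Local Notation m := m'.+1.
Implicit Types (p f : 'I_b -> R) (S : {set 'I_b}).

(* [share p j] is 1 / m! times the probability that m independent symbols of
   law p are pairwise distinct and one of them is j. *)
Definition share p j : R := p j * elsym (zap j p) m'.

Definition share_mean p : R := m%:R * elsym p m / b%:R.

Definition share_var p : R := \sum_j (share p j - share_mean p) ^+ 2.

(** By [sum_sub_mul_share], the inner product of p - 1/b with the centred [share p]. *)
Definition elsym_drop p : R :=
  (1 - m%:R / b%:R) * elsym p m - m.+1%:R * elsym p m.+1.

(** The centred coefficients of the linear form in f - 1/b that remains in [mixture_le] once k times
    the inner product with p has been added. *)
Definition corrected k p j : R :=
  k * (p j - b%:R^-1) - (share p j - share_mean p).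

Hypothesis b_gt0 : (0 < b)%N.
Let bR : b%:R != 0 :> R. Proof. by rewrite pnatr_eq0 -lt0n. Qed.

Lemma shareE p j : share p j = elsym p m - elsym (zap j p) m.
Proof. by rewrite (elsym_zap j) /share; ring. Qed.

Lemma sum_share p : \sum_j share p j = m%:R * elsym p m.
Proof. exact: sum_elsym_zap. Qed.

Lemma sum_mul_share p : \sum_l p l = 1 ->
  \sum_j p j * share p j = elsym p m - m.+1%:R * elsym p m.+1.
Proof.
move=> p1; rewrite -sum_elsym_zap -[elsym p m]mul1r -p1 mulr_suml -sumrB.
by apply: eq_bigr => j _; rewrite shareE; ring.
Qed.

Lemma sum_const_ord (x : R) : \sum_(j < b) x = b%:R * x.
Proof. by rewrite sumr_const card_ord mulr_natl. Qed.

Lemma sum_sub_mul_share p : \sum_l p l = 1 ->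
  \sum_j (p j - b%:R^-1) * (share p j - share_mean p) = elsym_drop p.
Proof.
move=> p1; transitivity (\sum_j p j * share p j - b%:R^-1 * \sum_j share p j
    - share_mean p * \sum_j p j + \sum_(j < b) b%:R^-1 * share_mean p).
  rewrite !mulr_sumr -!sumrB -big_split /=; apply: eq_bigr => j _; ring.
rewrite sum_mul_share // sum_share p1 sum_const_ord /elsym_drop /share_mean.
by field.
Qed.

Lemma sum_sub_sqr p : \sum_l p l = 1 ->
  \sum_j (p j - b%:R^-1) ^+ 2 = 1 - b%:R^-1 - 2 * elsym p 2.
Proof.
move=> p1; transitivity (\sum_j p j ^+ 2 - 2 * b%:R^-1 * \sum_j p j
    + \sum_(j < b) b%:R^-1 ^+ 2).
  rewrite !mulr_sumr -!sumrB -big_split /=; apply: eq_bigr => j _; ring.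
by rewrite elsym2 // p1 sum_const_ord; field.
Qed.

Lemma sum_corrected_sqr k p : \sum_l p l = 1 ->
  \sum_j corrected k p j ^+ 2 =
  k ^+ 2 * (1 - b%:R^-1 - 2 * elsym p 2) - 2 * k * elsym_drop p + share_var p.
Proof.
move=> p1; rewrite -sum_sub_sqr // -sum_sub_mul_share // /share_var.
rewrite !mulr_sumr -!sumrB -big_split /=; apply: eq_bigr => j _.
by rewrite /corrected; ring.
Qed.

(** Applied with y of sum zero, it turns an inner product into a sum over pairs of differences. *)
Lemma sum_sqr_diff (x y : 'I_b -> R) :
  \sum_i \sum_j (x i - x j) * (y i - y j) =
  2 * b%:R * (\sum_i x i * y i) - 2 * (\sum_i x i) * \sum_i y i.
Proof.
transitivity (\sum_i (b%:R * (x i * y i) - x i * (\sum_j y j) - y i * (\sum_j x j)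
   + \sum_j x j * y j)).
  apply: eq_bigr => i _; rewrite -sum_const_ord !mulr_sumr -!sumrB -big_split /=.
  by apply: eq_bigr => j _; ring.
rewrite big_split sumrB sumrB /= -!mulr_suml -mulr_sumr sum_const_ord.
by ring.
Qed.

(** In the difference the monomials that contain both i and j cancel. *)
Lemma share_diff p i j : share p i - share p j =
  (p i - p j) * elsym (zap i (zap j p)) m'.
Proof.
have [->|ij] := eqVneq i j; first by rewrite !subrr mul0r.
have zC : elsym (zap j (zap i p)) m' = elsym (zap i (zap j p)) m'.
  by apply: eq_elsym => l; rewrite /zap; case: (l == i); case: (l == j).
rewrite /share; case: (m') zC => [|r] zC; first by rewrite !elsym0; ring.
rewrite (elsym_zap j (zap i p)) (elsym_zap i (zap j p)) zC.
have -> : elsym (zap j (zap i p)) r = elsym (zap i (zap j p)) r.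
  by apply: eq_elsym => l; rewrite /zap; case: (l == i); case: (l == j).
have -> : zap i p j = p j by rewrite /zap eq_sym (negbTE ij).
have -> : zap j p i = p i by rewrite /zap (negbTE ij).
by ring.
Qed.

Lemma elsym_zap_le p i : (forall l, 0 <= p l) -> elsym (zap i p) m' <= elsym p m'.
Proof.
move=> p0; case: m' => [|r]; first by rewrite !elsym0.
by rewrite (elsym_zap i p) lerDl mulr_ge0 // elsym_ge0 //; exact: zap_ge0.
Qed.

(** By [share_diff], a difference of shares is the same difference of p times a factor between 0 and
    E, so its square is at most E times the product of the two differences. Summing over pairs with
    [sum_sqr_diff] gives the claim. *)
Lemma share_var_le p E : (forall l, 0 <= p l) -> \sum_l p l = 1 ->
  elsym p m' <= E -> share_var p <= E * elsym_drop p.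
Proof.
move=> p0 p1 pE.
pose v j := share p j - share_mean p.
have sv : \sum_j v j = 0.
  by rewrite sumrB sum_share sum_const_ord /share_mean; field.
have sp : \sum_j (p j - b%:R^-1) = 0 by rewrite sumrB p1 sum_const_ord mulfV ?subrr.
have b2 : 0 < 2 * b%:R :> R by rewrite mulr_gt0 // ltr0n.
rewrite -(ler_pM2l b2).
have -> : 2 * b%:R * share_var p = \sum_i \sum_j (v i - v j) * (v i - v j).
  by rewrite sum_sqr_diff sv mulr0 subr0.
have -> : 2 * b%:R * (E * elsym_drop p) =
    E * \sum_i \sum_j ((p i - b%:R^-1) - (p j - b%:R^-1)) * (v i - v j).
  by rewrite sum_sqr_diff sv mulr0 subr0 sum_sub_mul_share //; ring.
rewrite mulr_sumr; apply: ler_sum => i _; rewrite mulr_sumr; apply: ler_sum => j _.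
have -> : v i - v j = (p i - p j) * elsym (zap i (zap j p)) m'.
  by rewrite -share_diff /v; ring.
set e := elsym _ _.
have e0 : 0 <= e by apply: elsym_ge0; do 2!apply: zap_ge0.
have eE : e <= E.
  by apply: le_trans pE; apply: le_trans (elsym_zap_le _ _) (elsym_zap_le _ _); rewrite //; apply: zap_ge0.
rewrite -subr_ge0.
have -> : E * ((p i - b%:R^-1 - (p j - b%:R^-1)) * ((p i - p j) * e)) -
   (p i - p j) * e * ((p i - p j) * e) = (p i - p j) ^+ 2 * (e * (E - e)) by ring.
by rewrite mulr_ge0 ?sqr_ge0 // mulr_ge0 // subr_ge0.
Qed.

(** On a support of m symbols, m distinct symbols exhaust S: [share p] is constant on S and zero
    elsewhere, and [share_var p] equals m e_m times [elsym_drop p], where e_m is [elsym p m]. This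
    serves the coordinates restricted to a window. *)
Lemma share_var_supp p S E : (m <= b)%N -> simplex S p -> #|S| = m ->
  elsym p m <= E -> share_var p <= m%:R * E * elsym_drop p.
Proof.
move=> mb [p0 pS p1] Sm pE.
have aE j : share p j = if j \in S then elsym p m else 0.
  case: ifP => jS; last by rewrite /share pS ?jS // mul0r.
  rewrite shareE (@elsym_supp _ _ (zap j p) m (S :\ j)) ?subr0 //.
    move=> l; rewrite !inE negb_and negbK /zap; case: eqP => //= _; exact: pS.
  by move: (cardsD1 j S); rewrite jS Sm add1n => [[->]].
have e1 : elsym p m.+1 = 0 by apply: (elsym_supp pS); rewrite Sm.
have sum2 : \sum_j share p j ^+ 2 = m%:R * elsym p m ^+ 2.
  transitivity (\sum_(j in S) elsym p m ^+ 2); last by rewrite sumr_const Sm mulr_natl.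
  by rewrite [RHS]big_mkcond; apply: eq_bigr => j _; rewrite aE; case: ifP; rewrite ?expr0n.
have -> : share_var p = m%:R * elsym p m * elsym_drop p.
  transitivity (\sum_j share p j ^+ 2 - 2 * share_mean p * \sum_j share p j
     + \sum_(j < b) share_mean p ^+ 2).
    rewrite !mulr_sumr -!sumrB -big_split /=; apply: eq_bigr => j _; ring.
  by rewrite sum2 sum_share sum_const_ord /elsym_drop e1 /share_mean; field.
apply: ler_wpM2r; last by rewrite ler_wpM2l.
rewrite /elsym_drop e1 mulr0 subr0 mulr_ge0 ?elsym_ge0 // subr_ge0.
by rewrite ler_pdivrMr ?ltr0n // mul1r ler_nat.
Qed.

(* With g the deviation of f from the uniform vector, the average of <g, p>
   is |g|^2, which absorbs the square completed in <g, corrected k p>. *)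
Lemma mixture_le (I : finType) (w : I -> R) (P : I -> 'I_b -> R) f k K :
  0 < k -> (forall t, 0 <= w t) -> \sum_t w t = 1 ->
  (forall j, \sum_t w t * P t j = f j) ->
  (forall t, 0 < w t -> \sum_l P t l = 1 /\
     (1 - m%:R / b%:R) * elsym (P t) m
       + (\sum_j corrected k (P t) j ^+ 2) / (4 * k) <= K) ->
  \sum_t w t * (\sum_j f j * elsym (zap j (P t)) m) <= K.
Proof.
move=> k0 w0 w1 fE HK; pose g j := f j - b%:R^-1.
have f1 : \sum_j f j = 1.
  transitivity (\sum_j \sum_t w t * P t j); first by apply: eq_bigr => j _; rewrite fE.
  rewrite exchange_big /= -w1; apply: eq_bigr => t _; rewrite -mulr_sumr.
  have [/eqP w_t|w_t] := boolP (w t == 0); first by rewrite w_t mul0r.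
  by have [|-> _] := HK t; rewrite ?mulr1 // lt0r w_t w0.
have g0 : \sum_j g j = 0 by rewrite sumrB f1 sum_const_ord mulfV ?subrr.
have kn0 : k != 0 by rewrite gt_eqF.
have step t : 0 < w t -> \sum_j f j * elsym (zap j (P t)) m <=
    K + k * (\sum_j g j ^+ 2) - k * \sum_j g j * P t j.
  move=> /HK[Pt1 PtK]; set p := P t in Pt1 PtK *.
  have psiE : \sum_j f j * elsym (zap j p) m =
      (1 - m%:R / b%:R) * elsym p m - \sum_j g j * share p j.
    transitivity ((\sum_j f j) * elsym p m - b%:R^-1 * (\sum_j share p j)
       - \sum_j g j * share p j).
      rewrite mulr_suml mulr_sumr -!sumrB; apply: eq_bigr => j _.
      by rewrite /g shareE; ring.
    by rewrite f1 sum_share; field.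
  have cE : \sum_j g j * corrected k p j =
      k * (\sum_j g j * p j) - \sum_j g j * share p j.
    transitivity (k * (\sum_j g j * p j) - \sum_j g j * share p j
       + (share_mean p - k / b%:R) * \sum_j g j).
      rewrite !mulr_sumr -!sumrB -big_split; apply: eq_bigr => j _ /=.
      by rewrite /corrected; ring.
    by rewrite g0 mulr0 addr0.
  have sq : 0 <= (\sum_j corrected k p j ^+ 2) / (4 * k)
      + k * (\sum_j g j ^+ 2) - \sum_j g j * corrected k p j.
    rewrite mulr_suml mulr_sumr -big_split -sumrB /=; apply: sumr_ge0 => j _.
    have -> : corrected k p j ^+ 2 / (4 * k) + k * g j ^+ 2
       - g j * corrected k p j = (corrected k p j - 2 * k * g j) ^+ 2 / (4 * k) by field.
    by rewrite divr_ge0 ?sqr_ge0 // mulr_ge0 // ltW.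
  rewrite psiE; lra.
apply: (@le_trans _ _ (\sum_t w t * (K + k * (\sum_j g j ^+ 2)
    - k * \sum_j g j * P t j))).
  apply: ler_sum => t _; have [/eqP ->|w_t] := boolP (w t == 0); first by rewrite !mul0r.
  by rewrite ler_wpM2l // step // lt0r w_t w0.
have gE : \sum_t w t * (\sum_j g j * P t j) = \sum_j g j ^+ 2.
  transitivity (\sum_j g j * (f j - b%:R^-1 + b%:R^-1)).
    transitivity (\sum_j \sum_t g j * (w t * P t j)).
      rewrite exchange_big; apply: eq_bigr => t _; rewrite mulr_sumr.
      by apply: eq_bigr => j _; ring.
    by apply: eq_bigr => j _; rewrite -mulr_sumr fE subrK.
  under eq_bigr do rewrite mulrDr.
  by rewrite big_split /= -mulr_suml g0 mul0r addr0.
have -> : \sum_t w t * (K + k * (\sum_j g j ^+ 2) - k * \sum_j g j * P t j) =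
    (\sum_t w t) * (K + k * (\sum_j g j ^+ 2)) - k * \sum_t w t * \sum_j g j * P t j.
  rewrite [in RHS]mulr_suml [X in _ = _ - X]mulr_sumr -sumrB.
  by apply: eq_bigr => t _; ring.
by rewrite w1 gE; lra.
Qed.

Lemma sum_delta N n (x : nat -> R) : (n < N)%N ->
  \sum_(r < N) (val r == n)%:R * x r = x n.
Proof.
move=> nN; rewrite (bigD1 (Ordinal nN)) //= eqxx mul1r big1 ?addr0 // => r rn.
by rewrite -[_ == n]/(r == Ordinal nN) (negbTE rn) mul0r.
Qed.

(** By [elsym_unif], the value of [elsym] in degree r at the uniform law on n symbols. *)
Definition uelsym r n : R := 'C(n, r)%:R * n%:R^-1 ^+ r.

Lemma elsym_lin_le S (c0 c2 c3 c4 K : R) :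
  (forall n, (0 < n <= #|S|)%N ->
     c0 + c2 * uelsym 2 n + c3 * uelsym m n + c4 * uelsym m.+1 n <= K) ->
  forall p, simplex S p ->
     c0 + c2 * elsym p 2 + c3 * elsym p m + c4 * elsym p m.+1 <= K.
Proof.
move=> H p sp; pose N := m.+3.
(* Written as a sum of indicators, the coefficients stay correct when m or m + 1 equals 2. *)
pose c (r : nat) := c0 * (r == 0)%:R + c2 * (r == 2)%:R + c3 * (r == m)%:R
   + c4 * (r == m.+1)%:R.
have cE (x : nat -> R) : \sum_(r < N) c r * x r =
    c0 * x 0%N + c2 * x 2%N + c3 * x m + c4 * x m.+1.
  pose d n := \sum_(r < N) (val r == n)%:R * x r.
  transitivity (c0 * d 0%N + c2 * d 2%N + c3 * d m + c4 * d m.+1); last first.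
    by rewrite /d !sum_delta // /N !ltnS ?leqW.
  rewrite /d !mulr_sumr -!big_split /=.
  by apply: eq_bigr => r _; rewrite /c; ring.
have := @elsym_comb_le R b N c S K _ p sp.
rewrite /elsym_comb (cE (elsym p)) elsym0 mulr1; apply => n Hn.
by rewrite (cE (uelsym^~ n)) /uelsym bin0 expr0 !mulr1; exact: H.
Qed.

(** The quantity bounded in [corrected_le], taken at the uniform law on n symbols, with [share_var]
    replaced by E times [elsym_drop]. *)
Definition uniform_value k E n : R :=
  (1 - m%:R / b%:R) * uelsym m n + k / 4 * (1 - b%:R^-1 - 2 * uelsym 2 n)
  + (E / (4 * k) - 2^-1)
     * ((1 - m%:R / b%:R) * uelsym m n - m.+1%:R * uelsym m.+1 n).

(** Once the variance is replaced by its bound, the expression is affine in the elementary symmetric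
    polynomials of degrees 2, m and m + 1, so [elsym_lin_le] reduces it to uniform laws. *)
Lemma corrected_le S k E K : 0 < k ->
  (forall n, (0 < n <= #|S|)%N -> uniform_value k E n <= K) ->
  forall p, simplex S p -> share_var p <= E * elsym_drop p ->
  (1 - m%:R / b%:R) * elsym p m + (\sum_j corrected k p j ^+ 2) / (4 * k) <= K.
Proof.
move=> k0 H p sp vE; have [p0 pS p1] := sp.
have kn0 : k != 0 by rewrite gt_eqF.
pose q := E / (4 * k) - 2^-1.
have := @elsym_lin_le S (k / 4 * (1 - b%:R^-1)) (- (k / 2))
   ((1 + q) * (1 - m%:R / b%:R)) (- (q * m.+1%:R)) K.
move=> /(_ _ p sp) => H1.
apply: le_trans (H1 _); last first.
  move=> n Hn; apply: le_trans (H n Hn); rewrite le_eqVlt; apply/orP; left; apply/eqP.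
  by rewrite /uniform_value -/q; field.
rewrite sum_corrected_sqr //.
have : (k ^+ 2 * (1 - b%:R^-1 - 2 * elsym p 2) - 2 * k * elsym_drop p + share_var p)
    / (4 * k) <= (k ^+ 2 * (1 - b%:R^-1 - 2 * elsym p 2) - 2 * k * elsym_drop p
       + E * elsym_drop p) / (4 * k).
  by rewrite ler_pM2r ?invr_gt0 ?mulr_gt0 // lerD2l.
move=> /(lerD (lexx ((1 - m%:R / b%:R) * elsym p m)))/le_trans; apply.
rewrite le_eqVlt; apply/orP; left; apply/eqP; rewrite /elsym_drop /q; field.
by rewrite bR kn0.
Qed.

End KeyInequality.

(** * Values at uniform laws *)

Section UniformValues.
Variable R : realType.

(** Compared factor by factor: the chance that r uniform symbols are distinct grows with the
    alphabet. *)
Lemma ffact_pow_le n b r : (n <= b)%N -> (n ^_ r * b ^ r <= b ^_ r * n ^ r)%N.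
Proof.
move=> nb; elim: r => // r IHr; rewrite !ffactnSr !expnSr.
have -> : (n ^_ r * (n - r) * (b ^ r * b) = n ^_ r * b ^ r * ((n - r) * b))%N by ring.
have -> : (b ^_ r * (b - r) * (n ^ r * n) = b ^_ r * n ^ r * ((b - r) * n))%N by ring.
by apply: leq_mul => //; rewrite !mulnBl [(b * n)%N]mulnC leq_sub2l // leq_mul2l nb orbT.
Qed.

Lemma uelsymE r n : uelsym R r n = (n ^_ r)%:R / (r`!%:R * n%:R ^+ r).
Proof.
rewrite /uelsym -bin_ffact natrM exprVn invfM mulrA mulfK //.
Qed.

Lemma uelsym_le r n b : (0 < n <= b)%N -> uelsym R r n <= uelsym R r b.
Proof.
move=> /andP[n0 nb]; have b0 := leq_trans n0 nb; rewrite !uelsymE !invfM.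
have f0 : 0 < (r`!%:R : R)^-1 by rewrite invr_gt0 ltr0n fact_gt0.
rewrite ![_ * (_^-1 * _)]mulrCA ler_pM2l //.
rewrite ler_pdivrMr ?exprn_gt0 ?ltr0n // mulrAC ler_pdivlMr ?exprn_gt0 ?ltr0n //.
by rewrite -!natrX -!natrM ler_nat ffact_pow_le.
Qed.

Lemma elsym_le_uelsym b r (S : {set 'I_b}) (p : 'I_b -> R) :
  simplex S p -> elsym p r.+1 <= uelsym R r.+1 #|S|.
Proof.
move=> sp; have := @elsym_lin_le R b r S 0 0 1 0 _ _ p sp.
rewrite !mul0r !mul1r !add0r !addr0; apply => n Hn.
by rewrite !mul0r !mul1r !add0r !addr0 uelsym_le.
Qed.

Lemma uelsym2 n : (0 < n)%N -> uelsym R 2 n = (n%:R - 1) / (2 * n%:R).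
Proof.
move=> n0; rewrite uelsymE ffactnS ffactn1 natrM.
have -> : n.-1%:R = n%:R - 1 :> R by rewrite -subn1 natrB.
by rewrite (_ : 2`! = 2)%N //; field; rewrite pnatr_eq0 -lt0n.
Qed.

(** For n < r the subtraction is negative, but the falling factorial in front of it is 0. *)
Lemma ffactSr_natr n r : (n ^_ r.+1)%:R = (n ^_ r)%:R * (n%:R - r%:R) :> R.
Proof.
rewrite ffactnSr natrM; have [rn|nr] := leqP r n; first by rewrite natrB.
by rewrite ffact_small // !mul0r.
Qed.

Variables b m' : nat.
Local Notation m := m'.+1.
Hypothesis mb : (m < b)%N.

(** This is U / m!, since [elsym] counts sets of symbols where psi counts ordered choices. *)
Definition top_value : R := uelsym R m b * (1 - m%:R / b%:R).

(** The relative contribution allowed to a prefix coordinate: large enough for [prefix_uniform],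
    small enough for [gain_ln]. *)
Definition rho : R := 2 / (b%:R - 1).

(* The largest slope for which [uniform_value] is at most [top_value] at point
   masses. *)
Definition slope : R := 4 * top_value * b%:R / (b%:R - 1).

Let b0 : (0 < b)%N. Proof. exact: leq_ltn_trans mb. Qed.
Let bR : 0 < b%:R :> R. Proof. by rewrite ltr0n. Qed.
Let mR : 0 < m%:R :> R. Proof. by rewrite ltr0n. Qed.
Let bmR : 0 < b%:R - m%:R :> R. Proof. by rewrite subr_gt0 ltr_nat. Qed.
Let b1R : 0 < b%:R - 1 :> R.
Proof. by rewrite subr_gt0 ltr1n; apply: leq_ltn_trans mb. Qed.

Lemma top_value_gt0 : 0 < top_value.
Proof.
rewrite /top_value uelsymE mulr_gt0 //.
  by rewrite divr_gt0 ?mulr_gt0 ?exprn_gt0 // ltr0n ?fact_gt0 // ffact_gt0 ltnW.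
by rewrite subr_gt0 ltr_pdivrMr // mul1r ltr_nat.
Qed.

Lemma rho_gt0 : 0 < rho. Proof. by rewrite divr_gt0. Qed.

Lemma slope_gt0 : 0 < slope.
Proof. by have t0 := top_value_gt0; rewrite divr_gt0 // mulr_gt0 // mulr_gt0. Qed.

(* [suffix_lhs n <= suffix_rhs n] and [prefix_lhs <= prefix_rhs] are the
   inequalities of [suffix_uniform], and of [prefix_uniform] at n = m, with
   denominators cleared. *)
Definition suffix_lhs n : nat :=
  n ^_ m * b ^ m * (16 * n * (b - 1) * (b - m') * (b - m) ^ 2)
  + (b - n) * 16 * (b - m') * (b - m) ^ 2 * (n ^ m * b ^_ m)
  + m * (b - 1) * b * (n ^_ m * b ^ m) * m * (b - n) * (b - 1).

Definition suffix_rhs n : nat :=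
  16 * n * (b - 1) * (b - m') * (b - m) ^ 2 * (n ^ m * b ^_ m)
  + 8 * (b - m') * (b - m) * (n ^_ m * b ^ m) * m * (b - n) * (b - 1).


Lemma suffix_uniform n : (0 < n <= b)%N -> (suffix_lhs n <= suffix_rhs n)%N ->
  uniform_value b m' slope (uelsym R m' b) n <= top_value.
Proof.
move=> /andP[n0 nb] H; rewrite -subr_ge0 /uniform_value /slope /top_value uelsym2 //.
have m'b : (m' <= b)%N by rewrite ltnW // ltnW.
have fE : m`!%:R = m%:R * m'`!%:R :> R by rewrite factS natrM.
have fE2 : m.+1`!%:R = (m%:R + 1) * (m%:R * m'`!%:R) :> R by rewrite factS natrM fE natr1.
(* Everything is reduced to [n ^_ m], [b ^_ m'], the factorial of m' and two powers; once these are
   generalized, the identity is one of rational functions. *)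
rewrite !uelsymE [(n ^_ m.+1)%:R]ffactSr_natr fE fE2 -[m.+1%:R]natr1 [_ ^+ m.+1]exprS.
move: H (ffactSr_natr b m'); rewrite /suffix_lhs /suffix_rhs.
have := ffact_gt0 b m'; rewrite m'b.
have := fact_gt0 m'.
move: (n ^_ m) (b ^_ m) (b ^_ m') (m'`!) {fE fE2} => An Bm B F F0 B0 H BmE.
move: H; rewrite -(ler_nat R) -subr_ge0 !(natrD, natrM, natrX) !natrB ?(ltnW mb) //.
rewrite BmE !exprS expr0 !mulr1.
have Bn0 : 0 < B%:R :> R by rewrite ltr0n.
have Fn0 : 0 < F%:R :> R by rewrite ltr0n.
have bm'0 : 0 < b%:R - m'%:R :> R by rewrite subr_gt0 ltr_nat (ltn_trans _ mb).
have nR : 0 < n%:R :> R by rewrite ltr0n.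
have Y0 : 0 < n%:R ^+ m' :> R by rewrite exprn_gt0.
have X0 : 0 < b%:R ^+ m' :> R by rewrite exprn_gt0.
move: (n%:R ^+ m') (b%:R ^+ m') Y0 X0 => Y X Y0 X0.
have mR' : 0 < m%:R + 1 :> R by rewrite addr_gt0.
move: (An%:R) => A.
set D := (X in 0 <= X -> _); set G := (X in _ -> 0 <= X).
suff -> : G = D / (16 * n%:R ^+ 2 * (b%:R - 1) * (b%:R - m'%:R) * (b%:R - m%:R) * b%:R ^+ 2 * m%:R * F%:R * X * Y).
  by move=> D0; rewrite divr_ge0 // ltW // !mulr_gt0 ?exprn_gt0.
rewrite /G /D; move: (m%:R : R) mR bmR mR' => M M0 bM0 M1; field.
by rewrite !gt_eqF.
Qed.

Definition prefix_lhs : nat :=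
  8 * (b - m) * m * (b - 1) * ((b - 1) * m`! * b ^ m) * (2 * m ^ m * b ^_ m)
  + m ^ 2 * (b - 1) ^ 2 * ((b - 1) * m`! * b ^ m) ^ 2
  + 16 * (b - m) ^ 2 * (2 * m ^ m * b ^_ m) ^ 2.

Definition prefix_rhs : nat := 16 * (b - m) * m * (b - 1) * (2 * m ^ m * b ^_ m) ^ 2.

(** For n <= m the term of degree m + 1 vanishes. For n < m the term of degree m vanishes too, and
    the gap is a nonnegative multiple of n - 1 by the choice of [slope]. Only n = m needs the
    numerical hypothesis. *)
Lemma prefix_uniform n : (0 < n <= m)%N -> (prefix_lhs <= prefix_rhs)%N ->
  uniform_value b m' (rho * slope) (m%:R * uelsym R m m) n <= rho * top_value.
Proof.
move=> /andP[n0 nm] H; rewrite -subr_ge0 /uniform_value.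
have -> : uelsym R m.+1 n = 0 by rewrite uelsymE ffact_small ?mul0r.
have t0 := top_value_gt0; have r0 := rho_gt0; rewrite uelsym2 // mulr0 subr0.
have nR : 0 < n%:R :> R by rewrite ltr0n.
move: nm; rewrite leq_eqVlt => /orP[/eqP nm|nm]; last first.
  have -> : uelsym R m n = 0 by rewrite uelsymE ffact_small ?mul0r.
  have -> : rho * top_value - ((1 - m%:R / b%:R) * 0 + rho * slope / 4 *
     (1 - b%:R^-1 - 2 * ((n%:R - 1) / (2 * n%:R))) +
     (m%:R * uelsym R m m / (4 * (rho * slope)) - 2^-1) * ((1 - m%:R / b%:R) * 0))
     = rho * top_value * ((n%:R - 1) * b%:R / (n%:R * (b%:R - 1))).
    rewrite !mulr0 addr0 add0r /slope; field.
    by rewrite !gt_eqF.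
  have n1 : 0 <= n%:R - 1 :> R by rewrite subr_ge0 ler1n.
  apply: mulr_ge0; first by apply/ltW; apply: mulr_gt0.
  by apply: divr_ge0; [apply: mulr_ge0 => //|apply: mulr_ge0]; apply/ltW.
move: H n0 nR; rewrite nm => H n0 nR {nm n}; move: H.
rewrite /slope {1}/top_value /rho /top_value !uelsymE ffactnn /prefix_lhs /prefix_rhs.
have := ffact_gt0 b m; rewrite (ltnW mb); have := fact_gt0 m.
move: (b ^_ m) (m`!) => B F F0 B0.
rewrite -(ler_nat R) -subr_ge0 !(natrD, natrM, natrX) !natrB ?(ltnW mb) //.
have Bn0 : 0 < B%:R :> R by rewrite ltr0n.
have Fn0 : 0 < F%:R :> R by rewrite ltr0n.
have Y0 : 0 < m%:R ^+ m :> R by rewrite exprn_gt0.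
have X0 : 0 < b%:R ^+ m :> R by rewrite exprn_gt0.
move: (m%:R ^+ m) (b%:R ^+ m) Y0 X0 => Y X Y0 X0.
set D := (X in 0 <= X -> _); set G := (X in _ -> 0 <= X).
suff -> : G = D * (2 / (b%:R - 1) * (B%:R / (F%:R * X)) * (1 - m%:R / b%:R)) /
    (16 * (b%:R - m%:R) * m%:R * (b%:R - 1) * (2 * Y * B%:R) ^+ 2).
  have q0 : 0 <= 1 - m%:R / b%:R :> R.
    by rewrite subr_ge0 ler_pdivrMr // mul1r -subr_ge0 ltW.
  move=> D0; apply: divr_ge0; last first.
    by apply: mulr_ge0 (sqr_ge0 _); apply/ltW; do 3!apply: mulr_gt0 => //.
  do 2!(apply: mulr_ge0 => //); apply: mulr_ge0; first by apply/ltW/divr_gt0.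
  by apply/ltW/divr_gt0 => //; apply: mulr_gt0.
rewrite /G /D; move: (m%:R : R) mR bmR => M M0 bM0; field.
by rewrite !gt_eqF.
Qed.

End UniformValues.

(** * Numerical inequalities in binary arithmetic *)

Section BinaryChecks.
Local Open Scope nat_scope.
Import BinNat.

(** Binary numbers are used because the powers involved are too large to evaluate in unary [nat]. *)
Definition powN (x : nat) r : BinNums.N := iter r (N.mul (N.of_nat x)) (N.of_nat 1).

Definition ffactN (x : nat) r : BinNums.N :=
  foldr (fun i a => N.mul (N.of_nat (x - i)) a) (N.of_nat 1) (iota 0 r).

Lemma to_natM x y : N.to_nat (N.mul x y) = N.to_nat x * N.to_nat y.
Proof. exact: Nnat.N2Nat.inj_mul. Qed.

Lemma to_natD x y : N.to_nat (N.add x y) = N.to_nat x + N.to_nat y.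
Proof. exact: Nnat.N2Nat.inj_add. Qed.

Lemma powNE x r : N.to_nat (powN x r) = x ^ r.
Proof. by elim: r => // r IHr; rewrite /powN iterS to_natM Nnat.Nat2N.id IHr expnS. Qed.

Lemma ffactNE x r : N.to_nat (ffactN x r) = x ^_ r.
Proof.
rewrite ffact_prod -(big_mkord xpredT (fun i => x - i)) /index_iota subn0 /ffactN.
by elim: (iota 0 r) => [|i s IHs]; rewrite ?big_nil // big_cons /= to_natM Nnat.Nat2N.id IHs.
Qed.

Lemma lebN_leq x y : N.leb x y -> N.to_nat x <= N.to_nat y.
Proof. by move=> /N.leb_le/N.sub_add <-; rewrite to_natD leq_addl. Qed.

Definition prodN (s : seq nat) : BinNums.N :=
  foldr (fun x a => N.mul (N.of_nat x) a) (N.of_nat 1) s.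

Lemma prodNE s : N.to_nat (prodN s) = foldr muln 1 s.
Proof. by elim: s => //= x s IHs; rewrite to_natM Nnat.Nat2N.id IHs. Qed.

Definition suffix_check b m' n : bool :=
  let m := m'.+1 in
  let X := N.mul (ffactN n m) (powN b m) in
  let Y := N.mul (powN n m) (ffactN b m) in
  N.leb
    (N.add (N.add
      (N.mul X (prodN [:: 16; n; b - 1; b - m'; b - m; b - m]))
      (N.mul Y (prodN [:: b - n; 16; b - m'; b - m; b - m])))
      (N.mul X (prodN [:: m; b - 1; b; m; b - n; b - 1])))
    (N.add
      (N.mul Y (prodN [:: 16; n; b - 1; b - m'; b - m; b - m]))
      (N.mul X (prodN [:: 8; b - m'; b - m; m; b - n; b - 1]))).

Lemma suffix_checkP b m' n : suffix_check b m' n -> suffix_lhs b m' n <= suffix_rhs b m' n.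
Proof.
move=> /lebN_leq; rewrite !(to_natD, to_natM, powNE, ffactNE, prodNE).
set L := (X in X <= _ -> _); set L' := (X in _ <= X -> _).
suff [-> ->] : L = suffix_lhs b m' n /\ L' = suffix_rhs b m' n by [].
rewrite /L /L' /suffix_lhs /suffix_rhs [foldr _ _ _]/= [foldr _ _ [:: b - n; _; _; _; _]]/=.
rewrite [foldr _ _ [:: _; b - 1; _; _; _; _]]/= [foldr _ _ [:: 8; _; _; _; _; _]]/= .
move: (n ^_ _) (b ^_ _) (n ^ _) (b ^ _) (b - m'.+1) (b - m') (b - n) (b - 1).
by move=> *; split; ring.
Qed.

Definition prefix_check b m' : bool :=
  let m := m'.+1 in
  let X := N.mul (N.mul (prodN [:: b - 1]) (ffactN m m)) (powN b m) in
  let Y := N.mul (N.mul (prodN [:: 2]) (powN m m)) (ffactN b m) in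
  N.leb
    (N.add (N.add
      (N.mul (prodN [:: 8; b - m; m; b - 1]) (N.mul X Y))
      (N.mul (prodN [:: m; m; b - 1; b - 1]) (N.mul X X)))
      (N.mul (prodN [:: 16; b - m; b - m]) (N.mul Y Y)))
    (N.mul (prodN [:: 16; b - m; m; b - 1]) (N.mul Y Y)).

Lemma prefix_checkP b m' : prefix_check b m' -> prefix_lhs b m' <= prefix_rhs b m'.
Proof.
move=> /lebN_leq; rewrite !(to_natD, to_natM, powNE, ffactNE, prodNE) ffactnn.
rewrite /prefix_lhs /prefix_rhs.
move: (m'.+1 `!) (b ^_ _) (m'.+1 ^ _) (b ^ _) (b - m'.+1) (b - 1) => F B Y X d e.
set L := (X in X <= _ -> _); set L' := (X in _ <= X -> _).
set G := (X in _ -> X <= _); set G' := (X in _ -> _ <= X).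
have -> : G = L by rewrite /G /L /=; ring.
by have -> : G' = L' by rewrite /G' /L' /=; ring.
Qed.

(** The first inequality yields [gain_ln], the other two yield [full_rate_le]. The added 1 makes the
    first one strict. *)
Definition rate_check b m' : bool :=
  let m := m'.+1 in
  [&& N.leb (N.add (N.mul (prodN [:: b; b]) (powN m' (b - 3))) (N.of_nat 1)) (powN m (b - 1)),
      N.leb (N.mul (prodN [:: m'.-1]) (ffactN b m.+1)) (powN b m.+1) &
      N.leb (N.mul (prodN [:: b - m]) (powN m m'.-1)) (powN b m'.-1)].

Lemma rate_checkP b m' : rate_check b m' ->
  [/\ b ^ 2 * m' ^ (b - 3) < m'.+1 ^ (b - 1),
      m'.-1 * b ^_ m'.+2 <= b ^ m'.+2 &
      (b - m'.+1) * m'.+1 ^ m'.-1 <= b ^ m'.-1].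
Proof.
move=> /and3P[/lebN_leq c1 /lebN_leq c2 /lebN_leq c3]; split.
- by move: c1; rewrite !(to_natD, to_natM, powNE, prodNE, Nnat.Nat2N.id) /= muln1 addn1.
- by move: c2; rewrite !(to_natD, to_natM, powNE, ffactNE, prodNE) /= muln1.
- by move: c3; rewrite !(to_natD, to_natM, powNE, ffactNE, prodNE) /= muln1.
Qed.

(** With m = k - 2 one has m' = k - 3; the test [m'.+3 == k] ensures that the truncated subtraction
    loses nothing. *)
Definition pair_check (bk : nat * nat) : bool :=
  let: (b, k) := bk in let m' := k - 3 in
  [&& 3 <= m', m'.+3 == k, m'.+3 <= b,
      all (fun n => suffix_check b m' n) (iota 1 b), prefix_check b m' & rate_check b m'].

Lemma hash_pairs_check : all pair_check hash_pairs.
Proof. by vm_compute. Qed.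

End BinaryChecks.

(** * Hansel's lemma and averaging over boxes *)

Section Hansel.
Variables (R : realType) (b m n : nat) (C : {set n.-tuple 'I_b}).
Local Notation word := (n.-tuple 'I_b).
Implicit Types (x : {ffun 'I_m -> word}) (y : word) (i : 'I_n).

Definition symbols x i : {ffun 'I_m -> 'I_b} := [ffun j => tnth (x j) i].

Definition separates x i y : bool :=
  injectiveb (symbols x i) && (tnth y i \notin codom (symbols x i)).

Definition degree x y : nat := \sum_i separates x i y.

Lemma card_family_prod (I J : finType) (F : I -> pred J) :
  #|family F| = (\prod_i #|F i|)%N.
Proof. by rewrite card_family foldrE big_map big_enum. Qed.

(** The m words of x together with y and y' are m + 2 distinct codewords, so the code property
    applies to them. *)
Lemma hash_separates x y y' : hash_code m.+2 C -> injective x ->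
  (forall j, x j \in C) -> y \in C -> y' \in C -> y \notin codom x ->
  y' \notin codom x -> y != y' ->
  exists i, [&& separates x i y, separates x i y' & tnth y i != tnth y' i].
Proof.
move=> hC xi xC yC y'C yx y'x yy'.
pose S := (y |: (y' |: [set x j | j : 'I_m]))%SET.
have Sx j : x j \in S by rewrite !inE imset_f ?orbT.
have Sy : y \in S by rewrite !inE eqxx.
have Sy' : y' \in S by rewrite !inE eqxx orbT.
have [||i iinj] := hC S.
- by apply/fintype.subsetP => w; rewrite !inE => /or3P[/eqP->|/eqP->|/imsetP[j _ ->]].
- have im w : (w \in [set x j | j : 'I_m]%SET) = (w \in codom x).
    by apply/imsetP/codomP => [[j _ ->]|[j ->]]; exists j.
  by rewrite !cardsU1 card_imset // card_ord !inE !im (negbTE yx) (negbTE y'x) (negbTE yy').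
have sinj : injectiveb (symbols x i).
  by apply/injectiveP => j j'; rewrite !ffunE => /(iinj _ _ (Sx j) (Sx j'))/xi.
have sep w : w \in S -> w \notin codom x -> separates x i w.
  move=> Sw wx; rewrite /separates sinj /=; apply: contra wx => /codomP[j].
  by rewrite ffunE => /(iinj _ _ Sw (Sx j)) ->; rewrite codom_f.
exists i; rewrite !sep //=; apply: contra yy' => /eqP/(iinj _ _ Sy Sy')/eqP.
by [].
Qed.

(* Hansel's counting: colour each coordinate by a symbol avoiding x; two words
   compatible with the same colouring would not be separated anywhere. *)
Lemma hansel_count x (Y : {set word}) : hash_code m.+2 C -> injective x ->
  (forall j, x j \in C) -> (m < b)%N -> Y \subset C ->
  (forall y, y \in Y -> y \notin codom x) ->
  \sum_(y in Y) ((b - m)%:R ^+ degree x y)^-1 <= 1 :> R.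
Proof.
move=> hC xi xC mb YC Yx.
pose F i : pred 'I_b := [pred a | injectiveb (symbols x i) ==> (a \notin codom (symbols x i))].
pose Fy y i : pred 'I_b := [pred a | if separates x i y then a == tnth y i else F i a].
have cardF i : injectiveb (symbols x i) -> #|F i| = (b - m)%N.
  move=> si; rewrite (eq_card (B := [predC codom (symbols x i)])); last first.
    by move=> a; rewrite !inE si.
  have := cardC (mem (codom (symbols x i))).
  rewrite card_codom ?card_ord; last exact/injectiveP.
  by move=> /(congr1 (subn^~ m)); rewrite addKn => <-; apply: eq_card => a; rewrite !inE.
have F0 i : (0 < #|F i|)%N.
  have [si|/negbTE si] := boolP (injectiveb (symbols x i)).
    by rewrite cardF // subn_gt0.
  by apply/card_gt0P; exists (Ordinal (leq_ltn_trans (leq0n m) mb)); rewrite inE si.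
have famE y : (#|family (Fy y)| * (b - m) ^ degree x y = #|family F|)%N.
  rewrite !card_family_prod /degree expn_sum -big_split; apply: eq_bigr => i _ /=.
  have [sy|/negbTE sy] := boolP (separates x i y).
    have si : injectiveb (symbols x i) by case/andP: sy.
    rewrite cardF // expn1 (eq_card (B := pred1 (tnth y i))) ?card1 ?mul1n //.
    by move=> a; rewrite !inE sy.
  by rewrite expn0 muln1; apply: eq_card => a; rewrite !inE sy.
have FF0 : (0 < #|family F|)%N by rewrite card_family_prod prodn_gt0.
have sum_le : (\sum_(y in Y) #|family (Fy y)| <= #|family F|)%N.
  have sub y : {subset family (Fy y) <= family F}.
    move=> c /familyP cy; apply/familyP => i; have := cy i; rewrite !inE.
    by case: ifP => // /andP[si ny] /eqP ->; rewrite si.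
  under eq_bigr do rewrite -sum1_card.
  rewrite (exchange_big_dep (mem (family F))) /=; last by move=> y c _; exact: sub.
  rewrite -[leqRHS]sum1_card; apply: leq_sum => c _; rewrite sum1_card.
  apply/card_le1_eqP => y y' /andP[/= yY cy] /andP[/= y'Y cy'].
  apply/eqP; rewrite eq_sym; apply/negPn/negP => yy'.
  have [i /and3P[s1 s2]] := hash_separates hC xi xC (fintype.subsetP YC _ yY)
     (fintype.subsetP YC _ y'Y) (Yx _ yY) (Yx _ y'Y) yy'.
  move: cy cy' => /familyP/(_ i) + /familyP/(_ i).
  by rewrite !inE s1 s2 => /eqP <- /eqP <-; rewrite eqxx.
have d0 : 0 < (b - m)%:R :> R by rewrite ltr0n subn_gt0.
have eqt y : ((b - m)%:R ^+ degree x y)^-1 = #|family (Fy y)|%:R / #|family F|%:R :> R.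
  rewrite -(famE y) natrM natrX invfM mulrA mulfV ?mul1r //.
  by rewrite pnatr_eq0 -lt0n; move: FF0; rewrite -(famE y) muln_gt0 => /andP[].
under eq_bigr do rewrite eqt.
by rewrite -mulr_suml -natr_sum ler_pdivrMr ?ltr0n // mul1r ler_nat.
Qed.

(** Bounding each term of [hansel_count] below by 1 + z <= exp z, with z = ln #|Y| - degree * ln (b
    - m), turns that count into a bound on the sum of the degrees. *)
Lemma hansel x : hash_code m.+2 C -> injective x -> (forall j, x j \in C) ->
  (m < b)%N -> (m < #|C|)%N ->
  (#|C| - m)%:R * ln (#|C| - m)%:R <=
  ln (b - m)%:R * \sum_i #|[set y in C | separates x i y]%SET|%:R :> R.
Proof.
move=> hC xi xC mb mC.
pose Y := [set y in C | y \notin codom x]%SET.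
have YC : Y \subset C by apply/fintype.subsetP => y; rewrite inE => /andP[].
have Ycard : #|Y| = (#|C| - m)%N.
  have := cardsID [set y | y \in codom x]%SET C.
  rewrite (_ : #|C :&: _|%SET = m); last first.
    rewrite -[RHS]card_ord -(card_codom xi); apply: eq_card => y; rewrite !inE.
    by rewrite andb_idl // => /codomP[j ->].
  by move=> <-; rewrite addKn; apply: eq_card => y; rewrite !inE andbC.
have d0 : 0 < (b - m)%:R :> R by rewrite ltr0n subn_gt0.
have Y0 : 0 < #|Y|%:R :> R by rewrite ltr0n Ycard subn_gt0.
rewrite -Ycard.
(* A word of x is separated from x at no coordinate, so the counts may run over C instead of Y. *)
have degE : \sum_(y in Y) (degree x y)%:R = \sum_i #|[set y in C | separates x i y]%SET|%:R :> R.
  rewrite -!natr_sum; congr (_%:R); rewrite /degree exchange_big; apply: eq_bigr => i _.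
  rewrite -sum1_card big_mkcond [RHS]big_mkcond; apply: eq_bigr => y _ /=.
  rewrite !inE; case: (y \in C) => //=; have [|_] := boolP (y \in codom x).
    move=> /codomP[j ->]; rewrite /separates -[tnth _ _](ffunE (fun j => tnth (x j) i)) codom_f.
    by rewrite andbF.
  by case: separates.
have key : \sum_(y in Y) (1 + (ln #|Y|%:R - (degree x y)%:R * ln (b - m)%:R)) <= #|Y|%:R :> R.
  apply: (@le_trans _ _ (\sum_(y in Y) #|Y|%:R * ((b - m)%:R ^+ degree x y)^-1)).
    apply: ler_sum => y _; apply: le_trans (expR_ge1Dx _) _.
    by rewrite expRD lnK ?posrE // expRN expRM_natl lnK ?posrE.
  rewrite -mulr_sumr -[leRHS]mulr1 ler_pM2l //; apply: hansel_count => // y.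
  by rewrite inE => /andP[].
move: key; rewrite big_split sumrB /= -mulr_suml degE.
have sc (z : R) : \sum_(y in Y) z = #|Y|%:R * z by rewrite sumr_const mulr_natl.
by rewrite !sc; lra.
Qed.

End Hansel.

(** * Averaging Hansel's inequality over a subcode *)

Lemma elsym_scale (R : realFieldType) (T : finType) (a : R) (p : T -> R) r :
  elsym (fun l => a * p l) r = a ^+ r * elsym p r.
Proof.
rewrite !elsymE mulr_sumr; apply: eq_bigr => A /eqP <-.
by rewrite big_split prodr_const.
Qed.

(** Drawing without repetition costs a relative error of order 1/N. In the induction, multiplying by
    N - (m + 1) loses at most (m + 1) N^(m+1), and (m + 1)^2 + (m + 1) <= (m + 2)^2. *)
Lemma ffact_natr_ge (R : realFieldType) N m :
  N%:R ^+ m.+1 - m.+1%:R ^+ 2 * N%:R ^+ m <= (N ^_ m.+1)%:R :> R.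
Proof.
have N0 : 0 <= N%:R :> R by [].
elim: m => [|m IHm]; first by rewrite ffactn1 expr1n mul1r expr1 lerBlDr lerDl.
have le1 : (N%:R - m.+1%:R) * (N ^_ m.+1)%:R <= (N ^_ m.+2)%:R :> R.
  rewrite [N ^_ m.+2]ffactnSr natrM mulrC ler_wpM2l //.
  have [mN|mN] := leqP m.+1 N; first by rewrite natrB.
  by rewrite (le_trans _ (ler0n _ _)) // subr_le0 ler_nat ltnW.
apply: le_trans le1.
have le2 : (N ^_ m.+1)%:R <= N%:R ^+ m.+1 :> R.
  by rewrite -natrX ler_nat ffact_prod -[m.+1 in leqRHS]card_ord -prod_nat_const leq_prod // => i _; rewrite leq_subr.
have -> : m.+2%:R = m.+1%:R + 1 :> R by rewrite natr1.
have X0 := exprn_ge0 m N0; have m0 : 0 <= m.+1%:R :> R by [].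
move: IHm le2; rewrite !exprS !expr0 !mulr1.
move: (N%:R ^+ m) (N ^_ m.+1)%:R (m.+1%:R : R) m0 X0 => X F M M0 X0 h1 h2.
have h3 : N%:R * (N%:R * X - M * M * X) <= N%:R * F by rewrite ler_wpM2l.
have h4 : M * F <= M * (N%:R * X) by rewrite ler_wpM2l.
have h5 : 0 <= M * (N%:R * X) by rewrite !mulr_ge0.
have h6 : 0 <= N%:R * X by rewrite mulr_ge0.
rewrite mulrBl; apply: le_trans (lerB h3 h4); rewrite -subr_ge0.
have -> : N%:R * (N%:R * X - M * M * X) - M * (N%:R * X) -
  (N%:R * (N%:R * X) - (M + 1) * (M + 1) * (N%:R * X)) =
  M * (N%:R * X) + N%:R * X by ring.
by rewrite addr_ge0.
Qed.

Section SubcodeAverage.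
Variables (R : realType) (b m n : nat) (C : {set n.-tuple 'I_b}).
Local Notation word := (n.-tuple 'I_b).
Implicit Types (D : {set word}) (x : {ffun 'I_m -> word}) (i : 'I_n) (a : 'I_b).

Definition symcount D i a : R := #|[set w in D | tnth w i == a]%SET|%:R.

Definition dist D i a : R := symcount D i a / #|D|%:R.

(** The m words are chosen independently, so the number of choices with prescribed symbols at i is a
    product. *)
Lemma sum_symbols D i (G : {ffun 'I_m -> 'I_b} -> R) :
  \sum_(x : {ffun 'I_m -> word} | x \in ffun_on (mem D)) G (symbols x i) =
  \sum_s G s * \prod_j symcount D i (s j).
Proof.
rewrite (partition_big (fun x => symbols x i) xpredT) //=; apply: eq_bigr => s _.
rewrite (eq_bigr (fun=> G s)); last by move=> x /andP[_ /eqP ->].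
rewrite sumr_const -mulr_natr -natr_prod; congr (_ * _%:R).
transitivity #|family (fun j => [pred w | (w \in D) && (tnth w i == s j)])|; last first.
  rewrite card_family_prod; apply: eq_bigr => j _; apply: eq_card => w.
  by rewrite !inE.
apply: eq_card => x; rewrite unfold_in.
apply/andP/familyP => [[/ffun_onP xD /eqP <-] j|xF].
  by rewrite inE ffunE eqxx andbT; exact: xD.
split; first by apply/ffun_onP => j; have := xF j; rewrite inE => /andP[].
by apply/eqP/ffunP => j; rewrite ffunE; apply/eqP; have := xF j; rewrite inE => /andP[].
Qed.

(** Group y by its symbol a at i: injective words of symbols avoiding a are counted by
    [sum_inj_prod] with the weight of a set to zero. *)
Lemma sum_separates D i :
  \sum_(x : {ffun 'I_m -> word} | x \in ffun_on (mem D))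
    #|[set y in C | separates x i y]%SET|%:R =
  m`!%:R * \sum_a symcount C i a * elsym (zap a (symcount D i)) m.
Proof.
pose G a (s : {ffun 'I_m -> 'I_b}) : R := (injectiveb s && (a \notin codom s))%:R.
transitivity (\sum_(x : {ffun 'I_m -> word} | x \in ffun_on (mem D))
   \sum_a symcount C i a * G a (symbols x i)).
  apply: eq_bigr => x _; rewrite -sum1_card natr_sum.
  rewrite (partition_big (fun y => tnth y i) xpredT) //=; apply: eq_bigr => a _.
  rewrite -natr_sum sum1_card -natrM; congr (_%:R).
  have [sa|sa] := boolP (injectiveb (symbols x i) && (a \notin codom (symbols x i))).
    rewrite muln1; apply: eq_card => y; rewrite unfold_in !inE /separates.
    by case: eqP => [->|]; rewrite ?andbF // sa andbT.
  rewrite muln0; apply: eq_card0 => y; rewrite unfold_in !inE /separates.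
  by case: eqP => [->|]; rewrite ?andbF // (negbTE sa) andbF.
rewrite exchange_big mulr_sumr /=; apply: eq_bigr => a _.
rewrite -mulr_sumr mulrCA; congr (_ * _); rewrite (sum_symbols D i (G a)) -sum_inj_prod.
rewrite [RHS]big_mkcond; apply: eq_bigr => s _; rewrite /G.
have [si|_] := boolP (injectiveb s); last by rewrite mul0r.
have [|sa] := boolP (a \in codom s).
  by move=> /codomP[j aj]; rewrite mul0r (bigD1 j) //= /zap -aj eqxx mul0r.
rewrite mul1r; apply: eq_bigr => j _; rewrite /zap ifN //.
by apply: contraNneq sa => <-; exact: codom_f.
Qed.

Lemma symcount_dist D i : D != finset.set0 -> forall a, symcount D i a = #|D|%:R * dist D i a.
Proof.
by move=> D0 a; rewrite /dist mulrC mulfVK // pnatr_eq0 cards_eq0.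
Qed.

Lemma dist_ge0 D i a : 0 <= dist D i a. Proof. by rewrite divr_ge0. Qed.

Lemma sum_symcount D i : \sum_a symcount D i a = #|D|%:R.
Proof.
rewrite /symcount -natr_sum -[in RHS]sum1_card (partition_big (fun y => tnth y i) xpredT) //=.
congr (_%:R); apply: eq_bigr => a _; rewrite -sum1_card; apply: eq_bigl => w.
by rewrite inE.
Qed.

Lemma dist_sum D i : D != finset.set0 -> \sum_a dist D i a = 1.
Proof. by move=> D0; rewrite -mulr_suml sum_symcount mulfV // pnatr_eq0 cards_eq0. Qed.

(** Sum [hansel] over the injective choices x in D and normalize counts to laws; [ffact_natr_ge]
    accounts for the factor 1 - m^2 / #|D|. *)
Lemma subcode_ineq D : hash_code m.+2 C -> (0 < m < b)%N -> (m < #|C|)%N ->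
  D \subset C -> D != finset.set0 ->
  (1 - m%:R ^+ 2 / #|D|%:R) * ((#|C| - m)%:R / #|C|%:R * ln (#|C| - m)%:R) <=
  ln (b - m)%:R * m`!%:R *
    \sum_i \sum_a dist C i a * elsym (zap a (dist D i)) m.
Proof.
move=> hC /andP[m0 mb] mC DC D0.
have C0 : C != finset.set0 by rewrite -card_gt0; apply: leq_trans mC.
have d0 : 0 < #|D|%:R :> R by rewrite ltr0n card_gt0.
have c0 : 0 < #|C|%:R :> R by rewrite ltr0n card_gt0.
set L : R := ln (b - m)%:R.
have L0 : 0 <= L by rewrite ln_ge0 // ler1n subn_gt0.
set T : R := (#|C| - m)%:R * ln (#|C| - m)%:R.
have T0 : 0 <= T by rewrite mulr_ge0 // ln_ge0 // ler1n subn_gt0.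
have step1 : (#|D| ^_ m)%:R * T <= L * \sum_i (m`!%:R *
    \sum_a symcount C i a * elsym (zap a (symcount D i)) m).
  pose I := [set x : {ffun 'I_m -> word} in ffun_on (mem D) | injectiveb x]%SET.
  have -> : (#|D| ^_ m)%:R * T = \sum_(x in I) T.
    by rewrite sumr_const card_inj_ffuns_on card_ord mulr_natl.
  apply: (@le_trans _ _ (\sum_(x in I) L * \sum_i #|[set y in C | separates x i y]%SET|%:R)).
    apply: ler_sum => x; rewrite inE => /andP[/ffun_onP xD /injectiveP xi].
    by apply: hansel => // j; apply: (fintype.subsetP DC); exact: xD.
  rewrite -mulr_sumr ler_wpM2l // exchange_big; apply: ler_sum => i _.
  (* Admitting the choices x with repetitions only adds nonnegative terms. *)
  rewrite -sum_separates [leRHS](bigID (fun x : {ffun 'I_m -> word} => injectiveb x)) /=.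
  rewrite (eq_bigl (fun x => (x \in ffun_on (mem D)) && injectiveb x)); last first.
    by move=> x; rewrite inE.
  by rewrite lerDl sumr_ge0.
have step2 : \sum_i (m`!%:R * \sum_a symcount C i a * elsym (zap a (symcount D i)) m) =
   #|C|%:R * #|D|%:R ^+ m * (m`!%:R * \sum_i \sum_a dist C i a * elsym (zap a (dist D i)) m).
  rewrite mulrCA [in RHS]mulr_sumr [in RHS]mulr_sumr; apply: eq_bigr => i _; congr (_ * _).
  rewrite mulr_sumr; apply: eq_bigr => a _; rewrite (symcount_dist _ C0).
  have -> : elsym (zap a (symcount D i)) m = #|D|%:R ^+ m * elsym (zap a (dist D i)) m.
    rewrite -elsym_scale; apply: eq_elsym => l; rewrite /zap; case: eqP => _.
      by rewrite mulr0.
    exact: symcount_dist.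
  by ring.
rewrite step2 in step1.
have [m' mE] : exists m', m = m'.+1 by exists m.-1; rewrite prednK.
have step3 : #|D|%:R ^+ m * (1 - m%:R ^+ 2 / #|D|%:R) <= (#|D| ^_ m)%:R :> R.
  apply: le_trans (_ : _ <= (#|D| ^_ m'.+1)%:R) _; last by rewrite mE.
  rewrite mE; apply: le_trans (ffact_natr_ge R #|D| m'); rewrite le_eqVlt; apply/orP; left.
  apply/eqP; rewrite exprS; field; by rewrite gt_eqF.
have cd0 : 0 < #|C|%:R * #|D|%:R ^+ m :> R by rewrite mulr_gt0 // exprn_gt0.
rewrite -(ler_pM2l cd0).
have -> : #|C|%:R * #|D|%:R ^+ m * ((1 - m%:R ^+ 2 / #|D|%:R) *
    ((#|C| - m)%:R / #|C|%:R * ln (#|C| - m)%:R)) =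
    (#|D|%:R ^+ m * (1 - m%:R ^+ 2 / #|D|%:R)) * T.
  by rewrite /T; field; rewrite !gt_eqF.
apply: le_trans (ler_wpM2r T0 step3) _; apply: le_trans step1 _.
by rewrite le_eqVlt; apply/orP; left; apply/eqP; ring.
Qed.

End SubcodeAverage.

(** * Random boxes and the resulting bound on a code *)

Lemma card_ord_lt l n : (l <= n)%N -> #|[set i : 'I_n | (i < l)%N]%SET| = l.
Proof.
move=> le_ln; rewrite cardsE -sum1_card.
by rewrite -(big_ord_widen n (fun=> 1%N) le_ln) sum1_card card_ord.
Qed.

Section Boxes.
Variables (R : realType) (b' m' n l : nat).
Local Notation b := b'.+1.
Local Notation m := m'.+1.
Local Notation word := (n.-tuple 'I_b).
Implicit Types (t a : 'I_b) (w : word) (o : {ffun 'I_n -> 'I_b}).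
Hypotheses (mb : (m < b)%N) (le_ln : (l <= n)%N).

(* Alphabet windows are cyclic intervals of length m, so that every symbol lies
   in exactly m of the b windows. *)
Definition window t : {set 'I_b} := [set a | ((a - t)%R < m)%N]%SET.

Lemma card_window t : #|window t| = m.
Proof.
have := card_preimset [set i : 'I_b | (i < m)%N]%SET (addIr (- t)).
by rewrite card_ord_lt 1?ltnW // => <-; apply: eq_card => a; rewrite !inE.
Qed.

Lemma card_window_at a : #|[set t | a \in window t]%SET| = m.
Proof.
have := card_preimset [set i : 'I_b | (i < m)%N]%SET (@subrI _ a).
by rewrite card_ord_lt 1?ltnW // => <-; apply: eq_card => t; rewrite !inE.
Qed.

(** The index o lives on all n coordinates although only the first l are constrained; each choice of
    windows is thus repeated b^(n-l) times, which the normalization absorbs. *)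
Definition in_box o w : bool :=
  [forall i : 'I_n, (i < l)%N ==> (tnth w i \in window (o i))].

Definition boxes_at : nat := m ^ l * b ^ (n - l).

Lemma card_boxes_at w : #|[set o | in_box o w]%SET| = boxes_at.
Proof.
transitivity #|family (fun i : 'I_n => [pred t | (i < l)%N ==> (tnth w i \in window t)])|.
  by apply: eq_card => o; rewrite inE; apply/forallP/familyP => H i; exact: (H i).
rewrite card_family_prod (bigID (fun i : 'I_n => i < l)%N) /=; congr (_ * _)%N.
  rewrite (eq_bigr (fun=> m)); last first.
    move=> i il; rewrite -(card_window_at (tnth w i)); apply: eq_card => t.
    by rewrite [RHS]inE unfold_in /= il.
  by rewrite prod_nat_const; congr (_ ^ _)%N; rewrite -[RHS](card_ord_lt le_ln) cardsE.
rewrite (eq_bigr (fun=> b)); last first.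
  move=> i /negbTE il; rewrite -[RHS]card_ord; apply: eq_card => t.
  by rewrite unfold_in /= il.
rewrite prod_nat_const; congr (_ ^ _)%N.
have := cardC [pred i : 'I_n | (i < l)%N]; rewrite card_ord.
have -> : #|[pred i : 'I_n | (i < l)%N]| = l by rewrite -[RHS](card_ord_lt le_ln) cardsE.
by move=> /(congr1 (subn^~ l)); rewrite addKn => <-; apply: eq_card.
Qed.


Variable C : {set word}.
Hypotheses (hC : hash_code m.+2 C) (mC : (m < #|C|)%N).
Hypothesis suffix_ok : forall j, (0 < j <= b)%N -> (suffix_lhs b m' j <= suffix_rhs b m' j)%N.
Hypothesis prefix_ok : (prefix_lhs b m' <= prefix_rhs b m')%N.

Definition box_code o : {set word} := [set w in C | in_box o w]%SET.

(** The law of o when a codeword is drawn uniformly and then a box containing it. Hence the laws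
    within the boxes average to that of C ([box_weight_dist]), as [mixture_le] requires. *)
Definition box_weight o : R := #|box_code o|%:R / (#|C|%:R * boxes_at%:R).

Let C0 : C != finset.set0. Proof. by rewrite -card_gt0; apply: leq_trans mC. Qed.
Let c0 : 0 < #|C|%:R :> R. Proof. by rewrite ltr0n card_gt0. Qed.
Let M0 : 0 < boxes_at%:R :> R.
Proof. by rewrite ltr0n /boxes_at muln_gt0 !expn_gt0. Qed.

Lemma sum_box (P : pred word) :
  \sum_o #|[set w in box_code o | P w]%SET|%:R = boxes_at%:R * #|[set w in C | P w]%SET|%:R :> R.
Proof.
rewrite -natr_sum -natrM; congr (_%:R).
under eq_bigr do rewrite -sum1_card.
rewrite (exchange_big_dep (mem [set w in C | P w]%SET)) /=; last first.
  by move=> o w _; rewrite !inE => /andP[/andP[-> _] ->].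
rewrite mulnC -sum_nat_const; apply: eq_bigr => w; rewrite inE => /andP[wC Pw].
rewrite sum1_card -(card_boxes_at w); apply: eq_card => o.
by rewrite [RHS]inE -[LHS]/(w \in [set w in box_code o | P w]%SET) !inE wC Pw andbT.
Qed.

Lemma box_weight_sum : \sum_o box_weight o = 1.
Proof.
rewrite /box_weight -mulr_suml.
have -> : \sum_o #|box_code o|%:R = boxes_at%:R * #|C|%:R :> R.
  have DT (D : {set word}) : [set w in D | predT w]%SET = D.
    by apply/setP => w; rewrite inE andbT.
  by have := sum_box predT; rewrite DT; under eq_bigr do rewrite DT.
by rewrite [boxes_at%:R * _]mulrC mulfV // mulf_neq0 ?gt_eqF.
Qed.

Lemma box_weight_dist i a : \sum_o box_weight o * dist R (box_code o) i a = dist R C i a.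
Proof.
transitivity (\sum_o symcount R (box_code o) i a / (#|C|%:R * boxes_at%:R)).
  apply: eq_bigr => o _; rewrite /box_weight /dist.
  have [->|D0] := eqVneq (box_code o) finset.set0.
    rewrite cards0 !mul0r /symcount (_ : #|_| = 0%N) ?mul0r //.
    by apply: eq_card0 => w; rewrite !inE.
  by field; rewrite !gt_eqF //= ltr0n card_gt0.
rewrite -mulr_suml /symcount (sum_box (fun w => tnth w i == a)) /dist /symcount.
by field; rewrite !gt_eqF.
Qed.

(** [mixture_le] applies in both cases. Beyond l the laws have full support and [share_var_le] is
    used; below l they live on a window of size m and [share_var_supp] is used. *)
Lemma coordinate_le (i : 'I_n) :
  \sum_o box_weight o * (\sum_a dist R C i a * elsym (zap a (dist R (box_code o) i)) m)
  <= (if (i < l)%N then rho R b else 1) * top_value R b m'.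
Proof.
have b0 : (0 < b)%N by [].
have w0 o : 0 <= box_weight o by rewrite divr_ge0 // mulr_ge0.
have D0 o : 0 < box_weight o -> box_code o != finset.set0.
  by apply: contraTneq => E; rewrite /box_weight E cards0 mul0r ltxx.
have s0 := slope_gt0 R mb; have r0 := rho_gt0 R mb.
case: ifP => il; last first.
  rewrite mul1r; apply: (mixture_le b0 s0 w0 box_weight_sum) => [a|o /D0 oD].
    exact: box_weight_dist.
  have sT : simplex [set: 'I_b]%SET (dist R (box_code o) i).
    by split => [a|a|]; [exact: dist_ge0|rewrite inE|exact: dist_sum].
  split; first exact: dist_sum.
  apply: (corrected_le b0 s0 (E := uelsym R m' b) _ sT).
    by move=> j; rewrite cardsT card_ord => Hj; apply: suffix_uniform => //; exact: suffix_ok.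
  have pE : elsym (dist R (box_code o) i) m' <= uelsym R m' b.
    case: (m') => [|r]; first by rewrite elsym0 /uelsym bin0 expr0 mulr1.
    by have := elsym_le_uelsym r sT; rewrite cardsT card_ord.
  by case: sT => p0 _ p1; apply: share_var_le.
(* Scaling the slope by [rho] makes point masses reach exactly [rho] times [top_value]. *)
have k0 : 0 < rho R b * slope R b m' by rewrite mulr_gt0.
apply: (mixture_le b0 k0 w0 box_weight_sum) => [a|o /D0 oD].
  exact: box_weight_dist.
have sW : simplex (window (o i)) (dist R (box_code o) i).
  split => [a|a aW|]; [exact: dist_ge0| |exact: dist_sum].
  rewrite /dist /symcount (_ : #|_| = 0%N) ?mul0r //.
  apply: eq_card0 => w; rewrite !inE; apply: contraNF aW => /andP[/andP[_ /forallP/(_ i)]].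
  by rewrite il /= => wi /eqP <-.
split; first exact: dist_sum.
apply: (corrected_le b0 k0 (E := m%:R * uelsym R m m) _ sW).
  by move=> j; rewrite card_window => Hj; exact: prefix_uniform.
apply: (share_var_supp b0 (ltnW mb) sW (card_window _)).
by have := elsym_le_uelsym m' sW; rewrite card_window.
Qed.

(** The average of [subcode_ineq] over boxes. Weighted by [box_weight], the error m^2 / #|D| becomes
    independent of the box, and the b^n boxes together give m^2 (b / m)^l / #|C|. *)
Lemma code_bound :
  (1 - m%:R ^+ 2 * (b%:R / m%:R) ^+ l / #|C|%:R)
    * ((#|C| - m)%:R / #|C|%:R * ln (#|C| - m)%:R) <=
  ln (b - m)%:R * m`!%:R * (top_value R b m' * ((n - l)%:R + rho R b * l%:R)).
Proof.
set T : R := _%:R / _ * ln _; set L : R := ln _ * _.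
have T0 : 0 <= T by rewrite mulr_ge0 ?divr_ge0 // ln_ge0 // ler1n subn_gt0.
have L0 : 0 <= L by rewrite mulr_ge0 // ln_ge0 // ler1n subn_gt0.
pose psi o i := \sum_a dist R C i a * elsym (zap a (dist R (box_code o) i)) m.
have step o : (box_weight o - m%:R ^+ 2 / (#|C|%:R * boxes_at%:R)) * T <=
    L * \sum_i box_weight o * psi o i.
  have [D0|D0] := eqVneq (box_code o) finset.set0.
    rewrite /box_weight D0 cards0 !mul0r sub0r.
    under eq_bigr do rewrite mul0r.
    rewrite big1 // mulr0 mulNr oppr_le0; apply: mulr_ge0 => //.
  have d0 : 0 < #|box_code o|%:R :> R by rewrite ltr0n card_gt0.
  have -> : box_weight o - m%:R ^+ 2 / (#|C|%:R * boxes_at%:R) =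
      box_weight o * (1 - m%:R ^+ 2 / #|box_code o|%:R).
    by rewrite /box_weight; field; rewrite !gt_eqF.
  have -> : L * (\sum_i box_weight o * psi o i) = box_weight o * (L * \sum_i psi o i).
    by rewrite -mulr_sumr mulrCA.
  rewrite -[leLHS]mulrA; apply: ler_wpM2l.
    by rewrite divr_ge0 // mulr_ge0.
  apply: subcode_ineq => //.
  by apply/fintype.subsetP => w; rewrite inE => /andP[].
have sumP : \sum_(i < n) ((if (i < l)%N then rho R b else 1) * top_value R b m') =
    top_value R b m' * ((n - l)%:R + rho R b * l%:R) :> R.
  rewrite -mulr_suml mulrC; congr (_ * _).
  rewrite (bigID (fun i : 'I_n => i < l)%N) /= addrC; congr (_ + _).
    rewrite (eq_bigr (fun=> 1)); last by move=> i /negbTE ->.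
    rewrite sumr_const -[1 *+ _]/(_%:R); congr (_%:R).
    have := cardC [pred i : 'I_n | (i < l)%N]; rewrite card_ord.
    have -> : #|[pred i : 'I_n | (i < l)%N]| = l by rewrite -[RHS](card_ord_lt le_ln) cardsE.
    by move=> /(congr1 (subn^~ l)); rewrite addKn => <-; apply: eq_card.
  rewrite (eq_bigr (fun=> rho R b)); last by move=> i ->.
  rewrite sumr_const mulr_natr; congr (_ *+ _).
  by rewrite -[RHS](card_ord_lt le_ln) cardsE.
rewrite -sumP.
apply: (@le_trans _ _ (\sum_o L * \sum_i box_weight o * psi o i)); last first.
  rewrite -mulr_sumr ler_wpM2l // exchange_big; apply: ler_sum => i _.
  exact: coordinate_le.
apply: le_trans (ler_sum _ (fun o _ => step o)).
rewrite -mulr_suml sumrB box_weight_sum sumr_const card_ffun !card_ord.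
rewrite le_eqVlt; apply/orP; left; apply/eqP; congr ((1 - _) * _).
have -> : (b%:R / m%:R : R) ^+ l = (b ^ n)%:R / boxes_at%:R.
  rewrite /boxes_at -{1}(subnKC le_ln) expnD !natrM !natrX expr_div_n; field.
  by rewrite !expf_neq0 // pnatr_eq0.
by rewrite -[_ *+ (b ^ n)]mulr_natr; field; rewrite !gt_eqF.
Qed.

End Boxes.

(** * Growth of [A_hash] *)

(** Here th is the prefix length per coordinate, c the full rate and r = 1 - rho. Since c (1 - B /
    x1) = B, the last condition means th > B / (r x1), while th x2 < B means th < B / x2. The gap
    between these is open because x2 < r x1, and B < c <= x2 keeps th below 1. *)
Lemma rate_parameters (R : realType) (c x1 x2 r : R) :
  0 < c -> 0 < x1 -> 0 < x2 -> 0 < r -> x2 < r * x1 -> c <= x2 ->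
  let B := (x1^-1 + c^-1)^-1 in
  exists th ga, [/\ 0 < th, th <= 1, th * x2 < ga, ga < B & c * (1 - r * th) < B].
Proof.
move=> c0 x10 x20 r0 x21 cx2 B.
have cx : 0 < c + x1 by rewrite addr_gt0.
have BE : B = c * x1 / (c + x1) by rewrite /B; field; rewrite !gt_eqF // addr_gt0 ?invr_gt0.
have B0 : 0 < B by rewrite BE divr_gt0 // mulr_gt0.
have Bc : B < c by rewrite BE ltr_pdivrMr // ltr_pM2l // ltrDr.
have rx : 0 < r * x1 by rewrite mulr_gt0.
pose u := B / (r * x1); pose v := B / x2.
have u0 : 0 < u by rewrite divr_gt0.
have uv : u < v by rewrite /u /v ltr_pM2l // ltf_pV2 ?posrE.
have v1 : v < 1 by rewrite /v ltr_pdivrMr // mul1r (lt_le_trans Bc).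
have vx : v * x2 = B by rewrite /v mulfVK ?gt_eqF.
have ux : u * (r * x1) = B by rewrite /u mulfVK ?gt_eqF.
pose th := (u + v) / 2.
have uth : u < th by rewrite /th; lra.
have thv : th < v by rewrite /th; lra.
have thB : th * x2 < B by rewrite -vx ltr_pM2r.
exists th, ((th * x2 + B) / 2); split; [lra|lra|lra|lra|].
have rth : B / x1 < r * th.
  rewrite ltr_pdivrMr // -{1}ux; have -> : r * th * x1 = th * (r * x1) by ring.
  by rewrite ltr_pM2r.
have E : c * (1 - B / x1) = B by rewrite BE; field; rewrite !gt_eqF.
by rewrite -[ltRHS]E ltr_pM2l // ltrD2l ltrN2.
Qed.

Lemma A_hash_witness b k n :
  exists C : {set n.-tuple 'I_b}, hash_code k.+1 C /\ #|C| = A_hash b k.+1 n.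
Proof.
have h0 : hash_code k.+1 (finset.set0 : {set n.-tuple 'I_b}).
  by move=> S; rewrite finset.subset0 => /eqP ->; rewrite cards0.
have [|C hC CE] := @eq_bigmax_cond _
  [pred C : {set n.-tuple 'I_b} | `[< hash_code k.+1 C >]] (fun C => #|C|).
  by apply/card_gt0P; exists finset.set0; apply/asboolP.
by exists C; split; [exact/asboolP|rewrite -CE].
Qed.

Section Rate.
Variables (R : realType) (b' m' : nat).
Local Notation b := b'.+1.
Local Notation m := m'.+1.
Hypotheses (kb : (m'.+3 <= b)%N).
Hypothesis suffix_ok : forall j, (0 < j <= b)%N -> (suffix_lhs b m' j <= suffix_rhs b m' j)%N.
Hypothesis prefix_ok : (prefix_lhs b m' <= prefix_rhs b m')%N.

Let mb : (m < b)%N. Proof. exact: ltnW. Qed.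

Definition full_rate : R := ln (b - m)%:R * m`!%:R * top_value R b m'.

(** Either ln #|C| <= n ga, or #|C| exceeds exp (n ga), so that about (b / m)^(th n) boxes are few
    compared with #|C| and [code_bound] applies with negligible error. *)
Lemma ln_A_hash_le (th ga : R) : 0 < th -> th <= 1 -> th * ln (b%:R / m%:R) < ga ->
  exists K : R, forall n, (0 < n)%N ->
    ln (A_hash b m'.+3 n)%:R <=
    Num.max (n%:R * ga) (n%:R * (full_rate * (1 - (1 - rho R b) * th)) + K).
Proof.
move=> th0 th1 thga; set x2 := ln (b%:R / m%:R) in thga *.
have mR : 0 < m%:R :> R by rewrite ltr0n.
have bR : 0 < b%:R :> R by rewrite ltr0n.
have bmR : 1 < b%:R / m%:R :> R by rewrite ltr_pdivlMr // mul1r ltr_nat.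
have x20 : 0 < x2 by rewrite ln_gt0.
have et0 : 0 < ga - th * x2 by rewrite subr_gt0.
have ga0 : 0 < ga by apply: lt_trans thga; rewrite mulr_gt0.
have lnb0 : 0 <= ln b%:R :> R by rewrite ln_ge0 // ler1n.
have t0 := top_value_gt0 R mb.
have c0 : 0 <= full_rate.
  apply: mulr_ge0 (ltW t0); apply: mulr_ge0 => //.
  by rewrite ln_ge0 // ler1n subn_gt0.
have r1 : 0 <= 1 - rho R b.
  rewrite subr_ge0 /rho ler_pdivrMr ?mul1r; last first.
    by rewrite subr_gt0 ltr1n; apply: leq_trans kb.
  have : 3 <= b%:R :> R by rewrite ler_nat; apply: leq_trans kb.
  by lra.
set et := ga - th * x2 in et0.
(* In order: codes of at most 2 m words, the loss from halving #|C|, the relative errors s and t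
   times ln N', and the rounding of th n to an integer. *)
pose K : R := ln (2 * m)%:R + ln 2 + (m%:R ^+ 2 / et + m%:R / ga) * ln b%:R
   + full_rate * (1 - rho R b).
have ln2 : 0 <= ln 2 :> R by rewrite ln_ge0 // ler1n.
have q0 : 0 <= (m%:R ^+ 2 / et + m%:R / ga) * ln b%:R :> R.
  by rewrite mulr_ge0 // addr_ge0 // divr_ge0 ?sqr_ge0 // ltW.
have cr0 : 0 <= full_rate * (1 - rho R b) by rewrite mulr_ge0.
have ln2m : 0 <= ln (2 * m)%:R :> R by rewrite ln_ge0 // ler1n muln_gt0.
have rth : 0 <= 1 - (1 - rho R b) * th.
  have r2 := rho_gt0 R mb.
  have : (1 - rho R b) * th <= 1 * 1 by apply: ler_pM => //; [exact: ltW|lra].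
  lra.
exists K => n n0; have nR : 0 < n%:R :> R by rewrite ltr0n.
have [C [hC <-]] := A_hash_witness b m'.+2 n.
have [h|lnN] := leP (ln #|C|%:R) (n%:R * ga); first by rewrite le_max h.
rewrite le_max; apply/orP; right.
have nc0 : 0 <= n%:R * (full_rate * (1 - (1 - rho R b) * th)).
  by apply: mulr_ge0 => //; apply: mulr_ge0.
have [N2|N2] := leqP #|C| (2 * m).
  apply: (@le_trans _ _ (ln (2 * m)%:R)); last by rewrite /K; lra.
  have [->|N0] := posnP #|C|; first by rewrite ln0.
  by rewrite ler_ln ?posrE ?ltr0n // ler_nat.
have mC : (m < #|C|)%N by apply: leq_ltn_trans N2; rewrite mul2n -addnn leq_addr.
have N0 : 0 < #|C|%:R :> R by rewrite ltr0n; apply: leq_trans mC.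
pose l := Num.truncn (th * n%:R).
have /andP[l1 l2] : l%:R <= th * n%:R < l.+1%:R by rewrite truncn_itv // mulr_ge0 // ltW.
have ln_ : (l <= n)%N.
  by rewrite -(ler_nat R); apply: (le_trans l1); rewrite ler_piMl.
have := code_bound R mb ln_ hC mC suffix_ok prefix_ok.
have Nexp : expR (n%:R * ga) < #|C|%:R by rewrite -ltr_ln ?posrE ?expR_gt0 // expRK.
set s := m%:R ^+ 2 * _ / _; set N' : R := (#|C| - m)%:R.
have s0 : 0 <= s by rewrite !mulr_ge0 ?sqr_ge0 ?invr_ge0 ?exprn_ge0 // divr_ge0.
have N'E : N' = #|C|%:R - m%:R by rewrite /N' natrB // ltnW.
have N'ge : #|C|%:R / 2 <= N'.
  have : (2 * m)%:R <= #|C|%:R :> R by rewrite ler_nat ltnW.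
  by rewrite natrM N'E; lra.
have lnN'ge : ln #|C|%:R - ln 2 <= ln N'.
  rewrite -ln_div ?posrE // ler_ln ?posrE ?divr_gt0 //.
  by apply: lt_le_trans N'ge; rewrite divr_gt0.
have N'0 : 0 < N' by apply: lt_le_trans N'ge; rewrite divr_gt0.
have lnN'0 : 0 <= ln N' by rewrite ln_ge0 // /N' ler1n subn_gt0.
have lnN'le : ln N' <= n%:R * ln b%:R.
  rewrite mulr_natl -lnXn // ler_ln ?posrE ?exprn_gt0 // -natrX ler_nat.
  apply: leq_trans (leq_subr _ _) _; apply: leq_trans (max_card _) _.
  by rewrite card_tuple card_ord.
(* By exp z >= z the exponential gap gives an error of order 1/n, enough against ln N' <= n ln b. *)
have s_le : s <= m%:R ^+ 2 / et / n%:R.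
  have bml : (b%:R / m%:R) ^+ l <= expR (n%:R * (th * x2)) :> R.
    have -> : b%:R / m%:R = expR x2 by rewrite lnK // posrE divr_gt0.
    rewrite -expRM_natl ler_expR; have -> : n%:R * (th * x2) = th * n%:R * x2 by ring.
    by rewrite ler_wpM2r // ltW.
  have ee : expR (n%:R * (th * x2)) * (n%:R * et) <= #|C|%:R.
    apply: le_trans (ltW Nexp).
    have -> : n%:R * ga = n%:R * (th * x2) + n%:R * et by rewrite /et; ring.
    rewrite expRD ler_wpM2l ?expR_ge0 //; apply: le_trans (expR_ge1Dx _).
    by rewrite lerDr.
  have h : (b%:R / m%:R) ^+ l / #|C|%:R <= (n%:R * et)^-1 :> R.
    rewrite -[leRHS]mul1r ler_pdivlMr ?mulr_gt0 // mulrAC ler_pdivrMr // mul1r.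
    by apply: le_trans ee; rewrite ler_wpM2r // mulr_ge0 // ltW.
  have -> : m%:R ^+ 2 / et / n%:R = m%:R ^+ 2 * (n%:R * et)^-1.
    by field; rewrite !gt_eqF.
  by rewrite /s -mulrA ler_wpM2l ?sqr_ge0.
have t_le : m%:R / #|C|%:R <= m%:R / ga / n%:R :> R.
  rewrite -!mulrA ler_wpM2l // -invfM lef_pV2 ?posrE ?mulr_gt0 //.
  apply: le_trans (ltW Nexp); apply: le_trans (expR_ge1Dx _).
  by rewrite mulrC lerDr.
set t := m%:R / #|C|%:R in t_le.
have t_ge0 : 0 <= t by rewrite divr_ge0 // ltW.
have N'N : N' / #|C|%:R = 1 - t by rewrite N'E /t; field; rewrite gt_eqF.
rewrite N'N => main.
have main2 : (1 - s - t) * ln N' <= n%:R * (full_rate * (1 - (1 - rho R b) * th))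
    + full_rate * (1 - rho R b).
  apply: (@le_trans _ _ ((1 - s) * ((1 - t) * ln N'))).
    rewrite mulrA ler_wpM2r //.
    have : 0 <= s * t by rewrite mulr_ge0.
    by lra.
  apply: (le_trans main).
  have -> : ln (b - m)%:R * m`!%:R * (top_value R b m' * ((n - l)%:R + rho R b * l%:R))
     = full_rate * (n%:R - (1 - rho R b) * l%:R).
    by rewrite /full_rate [(n - l)%:R]natrB //; ring.
  have -> : n%:R * (full_rate * (1 - (1 - rho R b) * th)) + full_rate * (1 - rho R b)
     = full_rate * (n%:R - (1 - rho R b) * (th * n%:R - 1)) by ring.
  rewrite ler_wpM2l // lerB // ler_wpM2l //; move: l2; rewrite -natr1; lra.
have st : (s + t) * ln N' <= (m%:R ^+ 2 / et + m%:R / ga) * ln b%:R.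
  apply: (@le_trans _ _ ((m%:R ^+ 2 / et / n%:R + m%:R / ga / n%:R) * (n%:R * ln b%:R))).
    by apply: ler_pM; rewrite ?addr_ge0 // lerD.
  rewrite le_eqVlt; apply/orP; left; apply/eqP; field.
  by rewrite !gt_eqF.
rewrite /K; move: main2; rewrite -addrA -opprD mulrBl mul1r; lra.
Qed.

End Rate.

(** * The strict inequality for the rate *)

Lemma limn_esup_le_near (R : realType) (u : nat -> \bar R) (M : \bar R) n0 :
  (forall n, (n0 <= n)%N -> (u n <= M)%E) -> (limn_esup u <= M)%E.
Proof.
move=> uM; apply: (@Order.POrderTheory.le_trans _ _ (ereal_sup (u @` [set n | (n0 <= n)%N])%classic)).
  apply: ereal_inf_lbound; exists [set n | (n0 <= n)%N]%classic => //.
  exact: nbhs_infty_ge.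
by apply: ge_ereal_sup => _ [n /= nn <-]; exact: uM.
Qed.

Section StrictRate.
Variables (R : realType) (b' m' : nat).
Local Notation b := b'.+1.
Local Notation m := m'.+1.
Hypotheses (m'3 : (3 <= m')%N) (kb : (m'.+3 <= b)%N).
Hypothesis suffix_ok : forall j, (0 < j <= b)%N -> (suffix_lhs b m' j <= suffix_rhs b m' j)%N.
Hypothesis prefix_ok : (prefix_lhs b m' <= prefix_rhs b m')%N.
Hypothesis gain : (b ^ 2 * m' ^ (b - 3) < m ^ (b - 1))%N.
Hypothesis density_small : (m'.-1 * b ^_ m.+1 <= b ^ m.+1)%N.
Hypothesis parts_small : ((b - m) * m ^ m'.-1 <= b ^ m'.-1)%N.

Let mb : (m < b)%N. Proof. exact: ltnW. Qed.
Let bR : 0 < b%:R :> R. Proof. by rewrite ltr0n. Qed.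
Let mR : 0 < m%:R :> R. Proof. by rewrite ltr0n. Qed.
Let m'R : 0 < m'%:R :> R. Proof. by rewrite ltr0n; apply: leq_trans m'3. Qed.

Let x1 : R := ln (b%:R / m'%:R).
Let x2 : R := ln (b%:R / m%:R).

Let x1E : x1 = ln b%:R - ln m'%:R. Proof. by rewrite /x1 ln_div ?posrE. Qed.
Let x2E : x2 = ln b%:R - ln m%:R. Proof. by rewrite /x2 ln_div ?posrE. Qed.

Lemma full_rateE : full_rate R b' m' = ln (b - m)%:R * ((b ^_ m.+1)%:R / (b ^ m.+1)%:R).
Proof.
rewrite /full_rate -mulrA; congr (_ * _); rewrite /top_value uelsymE [in RHS]ffactSr_natr.
rewrite [in RHS]natrX [b%:R ^+ m.+1]exprS.
have f0 : m`!%:R != 0 :> R by rewrite pnatr_eq0 -lt0n fact_gt0.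
have X0 : b%:R ^+ m != 0 :> R by rewrite expf_neq0 // gt_eqF.
move: (m`!%:R : R) (b%:R ^+ m) ((b ^_ m)%:R : R) f0 X0 => F X A f0 X0.
by field; rewrite f0 X0 gt_eqF.
Qed.

Lemma full_rate_gt0 : 0 < full_rate R b' m'.
Proof.
have t0 := top_value_gt0 R mb.
apply: mulr_gt0 t0; apply: mulr_gt0; last by rewrite ltr0n fact_gt0.
by rewrite ln_gt0 // ltr1n ltn_subRL addn1.
Qed.

Lemma ln_expn (a r : nat) : (0 < a)%N -> ln (a ^ r)%:R = r%:R * ln a%:R :> R.
Proof. by move=> a0; rewrite natrX lnXn ?ltr0n // mulr_natl. Qed.

(** As 1 - rho = (b - 3) / (b - 1), this is the logarithm of [gain] divided by b - 1. It compares
    windows of size k - 2, with box cost x2, to windows of size k - 3, with box cost x1. *)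
Lemma gain_ln : x2 < (1 - rho R b) * x1.
Proof.
have b1 : 0 < b%:R - 1 :> R by rewrite subr_gt0 ltr1n; apply: leq_trans mb.
have : ln (b ^ 2 * m' ^ (b - 3))%:R < ln (m ^ (b - 1))%:R :> R.
  by rewrite ltr_ln ?posrE ?ltr_nat // ltr0n ?muln_gt0 ?expn_gt0 //=; rewrite -(ltr0n R) m'R.
rewrite natrM lnM ?posrE ?ltr0n ?expn_gt0 //; last by rewrite -(ltr0n R) m'R.
rewrite !ln_expn //; last by rewrite -(ltr0n R).
rewrite !natrB //; last by apply: leq_trans kb.
move=> h; rewrite x1E x2E -subr_gt0.
have -> : (1 - rho R b) * (ln b%:R - ln m'%:R) - (ln b%:R - ln m%:R) =
  ((b%:R - 1) * ln m%:R - (2 * ln b%:R + (b%:R - 3) * ln m'%:R)) / (b%:R - 1).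
  by rewrite /rho; move: (b%:R : R) b1 => bb b1; field; rewrite gt_eqF.
by rewrite divr_gt0 // subr_gt0.
Qed.

(** The two factors of the rate are bounded separately: U <= 1 / (m' - 1), and ln (b - m) <= (m' -
    1) x2. *)
Lemma full_rate_le : full_rate R b' m' <= x2.
Proof.
have m10 : 0 < m'.-1%:R :> R by rewrite ltr0n -ltnS prednK; apply: leq_trans m'3.
have bm : (0 < b - m)%N by rewrite subn_gt0.
have B0 : 0 < (b ^ m.+1)%:R :> R by rewrite ltr0n expn_gt0.
have h1 : (b ^_ m.+1)%:R / (b ^ m.+1)%:R <= m'.-1%:R^-1 :> R.
  rewrite -[leRHS]mul1r ler_pdivlMr // mulrAC ler_pdivrMr // mul1r -natrM ler_nat.
  by rewrite mulnC.
have h2 : ln (b - m)%:R <= m'.-1%:R * x2.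
  have : ln ((b - m) * m ^ m'.-1)%:R <= ln (b ^ m'.-1)%:R :> R.
    by rewrite ler_ln ?posrE ?ler_nat // ltr0n ?muln_gt0 ?expn_gt0 //= bm.
  rewrite natrM lnM ?posrE ?ltr0n ?expn_gt0 // !ln_expn // x2E => h.
  by rewrite mulrBr lerBrDr.
have l0 : 0 <= ln (b - m)%:R :> R by rewrite ln_ge0 // ler1n.
rewrite full_rateE; apply: (@le_trans _ _ (m'.-1%:R * x2 * m'.-1%:R^-1)).
  by apply: ler_pM => //; rewrite divr_ge0.
by rewrite mulrAC mulfV ?mul1r // gt_eqF.
Qed.

(** The bound is homogeneous of degree 1 in the logarithms, so the change of base comes out as 1 /
    ln 2. *)
Lemma hash_boundE :
  hash_bound b m'.+3 = (x1^-1 + (full_rate R b' m')^-1)^-1 / ln 2 :> R.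
Proof.
have l20 : 0 < ln 2 :> R by rewrite ln_gt0 // ltr1n.
have f0 := full_rate_gt0.
have x10 : 0 < x1 by rewrite ln_gt0 // ltr_pdivlMr // mul1r ltr_nat; apply: leq_trans mb.
have k3 : (m'.+3 - 3 = m')%N by rewrite !subSS subn0.
have k1 : (m'.+3 - 1 = m.+1)%N by rewrite subn1.
have kb2 : (b - m'.+3 + 2 = b - m)%N.
  by rewrite addnC addnBA // -[m'.+3]/(2 + m)%N subnDl.
have lbm : 0 < ln (b - m)%:R :> R by rewrite ln_gt0 // ltr1n ltn_subRL addn1.
have F0 : 0 < (b ^_ m.+1)%:R :> R by rewrite ltr0n ffact_gt0.
have B0 : 0 < (b ^ m.+1)%:R :> R by rewrite ltr0n expn_gt0.
rewrite /hash_bound k3 k1 kb2 /log2 -/x1 full_rateE.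
move: F0 B0; move: (b ^_ m.+1)%:R (b ^ m.+1)%:R => F B F0 B0.
field; rewrite !gt_eqF //= ?addr_gt0 ?mulr_gt0 //.
Qed.

Lemma R_hash_lt : (@R_hash R b m'.+3 < (hash_bound b m'.+3)%:E)%E.
Proof.
have f0 := full_rate_gt0.
have l20 : 0 < ln 2 :> R by rewrite ln_gt0 // ltr1n.
have x10 : 0 < x1 by rewrite ln_gt0 // ltr_pdivlMr // mul1r ltr_nat; apply: leq_trans mb.
have x20 : 0 < x2 by rewrite ln_gt0 // ltr_pdivlMr // mul1r ltr_nat.
have r0 : 0 < 1 - rho R b.
  by have := lt_trans x20 gain_ln; rewrite pmulr_lgt0.
have [th [ga [th0 th1 thga gaB rB]]] :=
  rate_parameters f0 x10 x20 r0 gain_ln full_rate_le.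
have [K HK] := ln_A_hash_le kb suffix_ok prefix_ok th0 th1 thga.
rewrite hash_boundE; set B := (_ + _)^-1 in gaB rB *.
set c1 := full_rate R b' m' * _ in rB HK.
(* Strictly between both rates and B: the limit superior only inherits a weak inequality, and the
   additive K needs some room. *)
pose M := (Num.max ga c1 + B) / 2.
have mx : Num.max ga c1 < B by rewrite gt_max gaB.
have MB : M < B by rewrite /M; lra.
have mga : ga <= Num.max ga c1 by rewrite le_max lexx.
have mc1 : c1 <= Num.max ga c1 by rewrite le_max lexx orbT.
have gaM : ga <= M by rewrite /M; lra.
have c1M : c1 < M by rewrite /M; lra.
apply: (@Order.POrderTheory.le_lt_trans _ _ (M / ln 2)%:E); last first.
  by rewrite lte_fin ltr_pM2r ?invr_gt0.
(* From here on n (M - c1) >= K, so the additive constant is absorbed. *)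
pose n0 := (Num.truncn (Num.max 0 (K / (M - c1)))).+1.
apply: (@limn_esup_le_near _ _ _ n0) => n nn; rewrite lee_fin /log2.
have np : (0 < n)%N by apply: leq_trans nn.
have nR : 0 < n%:R :> R by rewrite ltr0n.
rewrite ler_pdivrMr // mulrAC ler_pM2r ?invr_gt0 //.
apply: (le_trans (HK n np)); rewrite ge_max [M * _]mulrC ler_pM2l // gaM /=.
have Mc : 0 < M - c1 by rewrite subr_gt0.
have : K / (M - c1) <= n%:R.
  apply: (@le_trans _ _ (Num.max 0 (K / (M - c1)))); first by rewrite le_max lexx orbT.
  have mx0 : 0 <= Num.max 0 (K / (M - c1)) by rewrite le_max lexx.
  have /andP[_ /ltW h] := truncn_itv mx0; apply: (le_trans h).
  by rewrite ler_nat.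
rewrite ler_pdivrMr // => h.
have -> : n%:R * M = n%:R * c1 + n%:R * (M - c1) by ring.
by rewrite lerD2l.
Qed.

End StrictRate.

Theorem mainTheorem15 (R : realType) (b k : nat) :
  (b, k) \in hash_pairs ->
  (@R_hash R b k < (hash_bound b k)%:E)%E.
Proof.
move=> /(fun h => allP hash_pairs_check _ h) /and5P[].
rewrite /pair_check => m3 /eqP kE kb /allP suffix /andP[prefix rate].
set m' := (k - 3)%N in m3 kE kb suffix prefix rate; rewrite -kE.
have [c1 c2 c3] := rate_checkP rate.
(* The cyclic windows use addition modulo b on ['I_b], which requires a successor as alphabet
   size. *)
have bE : b = b.-1.+1 by rewrite prednK //; apply: leq_trans kb.
rewrite bE in kb suffix prefix rate c1 c2 c3 *.
apply: R_hash_lt => //; last exact: prefix_checkP.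
by move=> j /andP[j0 jb]; apply/suffix_checkP/suffix; rewrite mem_iota j0.
Qed.
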